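(* Let $(M^{2m},\varphi,g)$ be a para-Kähler-Norden manifold, $T^{\varphi}_{1}M$ its $\varphi$-unit tangent bundle equipped with the $\varphi$-Sasaki metric, and $F$ a $(1,1)$-tensor field on $M$. A curve $\Gamma=(\gamma(t),\xi(t))$ on $T^{\varphi}_{1}M$ is ${}^{H}F$-planar with respect to $\widehat\nabla$ if and only if there are functions $\varrho_1,\varrho_2$ of the parameter $t$ such that $$\gamma_t''=R(\xi_t',\varphi\xi)\gamma_t'+\varrho_1\gamma_t'+\varrho_2F\gamma_t',\qquad \xi_t''=\varrho_1\xi_t'+\varrho_2F\xi_t'-\rho^2\xi,$$ where $\rho$ is a constant with $0\le\rho\le1$ and $\rho^2=g(\xi_t',\varphi\xi_t')$.
   Context: A para-Kähler-Norden manifold $(M^{2m},\varphi,g)$ is a $2m$-dimensional Riemannian manifold $(M,g)$ with a $(1,1)$-tensor field $\varphi$ such that $\varphi^2=\mathrm{id}$, $\varphi\ne\pm\mathrm{id}$, the $+1$ and $-1$ eigenbundles of $\varphi$ have equal rank, $g(\varphi X,Y)=g(X,\varphi Y)$, and $\nabla\varphi=0$, where $\nabla$ is the Levi-Civita connection of $g$. $R(X,Y)Z=\nabla_X\nabla_YZ-\nabla_Y\nabla_XZ-\nabla_{[X,Y]}Z$. Points of $TM$ are written $(x,\xi)$; ${}^{H}X$, ${}^{V}X$ are the horizontal (with respect to $\nabla$) and vertical lifts to $TM$. The $\varphi$-Sasaki metric $g^\varphi$ on $TM$ is defined by $g^\varphi({}^HX,{}^HY)=g(X,Y)$, $g^\varphi({}^HX,{}^VY)=0$,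 $g^\varphi({}^VX,{}^VY)=g(X,\varphi Y)$. The $\varphi$-unit tangent bundle is the hypersurface $T^{\varphi}_{1}M=\{(x,\xi)\in TM: g(\xi,\varphi\xi)=1\}$, equipped with the metric induced by $g^\varphi$; $\widehat\nabla$ is the Levi-Civita connection of this induced metric. The horizontal lift ${}^HF$ of $F$ is the $(1,1)$-tensor field on $TM$ with ${}^HF({}^HX)={}^H(FX)$ and ${}^HF({}^VX)={}^V(FX)$. A curve $\Gamma=(\gamma(t),\xi(t))$ consists of a curve $\gamma$ on $M$ and a vector field $\xi$ along $\gamma$. Write $\gamma_t'=d\gamma/dt$, $\gamma_t''=\nabla_{\gamma_t'}\gamma_t'$, $\xi_t'=\nabla_{\gamma_t'}\xi$, $\xi_t''=\nabla_{\gamma_t'}\xi_t'$; then $\Gamma_t'={}^H\gamma_t'+{}^V\xi_t'$. $\Gamma$ is ${}^HF$-planar with respect to $\widehat\nabla$ if $\widehat\nabla_{\Gamma_t'}\Gamma_t'=\varrho_1\Gamma_t'+\varrho_2\,{}^HF\,\Gamma_t'$ (an equality of vectors tangent to $TM$ along $\Gamma$) for some functions $\varrho_1,\varrho_2$ of $t$.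
   Formalization: That g(ξ',φξ') equals ρ² for a constant ρ with 0≤ρ≤1 is assumed of the curve rather than concluded from planarity; as a conclusion it fails for flat R², φ=diag(1,−1), γ constant, ξ=(cosh t, sinh t), which is planar with g(ξ',φξ')=−1. *)

(* Defs.v *)
From HB Require Import structures.
From mathcomp Require Import all_boot all_order all_algebra.
From mathcomp Require Import all_classical all_reals all_analysis.

Set Implicit Arguments.
Unset Strict Implicit.
Unset Printing Implicit Defensive.

Import Order.TTheory GRing.Theory Num.Theory.
Import numFieldNormedType.Exports.

Local Open Scope classical_set_scope.
Local Open Scope ring_scope.

(* Conventions.  Everything is written in charts.  Coordinate vectors are row
   vectors, so an endomorphism A acts by v |-> v *m A and the differential of f
   at y acts by v |-> v *m 'J f y.  A tensor field is given by its components in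
   every chart, subject to the usual transformation rule. *)

(** * C^oo maps *)

Section smooth.
Context {R : realType}.

Fixpoint Ck n (W : normedModType R) (k : nat) (U : set 'rV[R]_n)
    (f : 'rV[R]_n -> W) : Prop :=
  match k with
  | 0 => forall y, U y -> {for y, continuous f}
  | k'.+1 => (forall y, U y -> differentiable f y) /\
      (forall i : 'I_n, Ck k' U (fun y => 'D_(delta_mx 0 i) f y))
  end.

Definition smooth_on n (W : normedModType R) (U : set 'rV[R]_n)
  (f : 'rV[R]_n -> W) : Prop := forall k, Ck k U f.

Definition smooth_curve (W : normedModType R) (J : set R) (c : R -> W) : Prop :=
  forall k t, J t -> derivable (derive1n k c) t 1.

End smooth.

(** * Smooth manifolds *)

Record manifold (R : realType) (n : nat) := Manifold {
  point :> topologicalType;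
  hausdorff_point : hausdorff_space point;
  second_countable_point : @second_countable point;
  chart : Type;
  dom : chart -> set point;
  crd : chart -> point -> 'rV[R]_n;
  par : chart -> 'rV[R]_n -> point;   (* the inverse of [crd] on its image *)
  img := fun a => crd a @` dom a;
  open_dom : forall a, open (dom a);
  open_img : forall a, open (img a);
  crdK : forall a x, dom a x -> par a (crd a x) = x;
  continuous_crd : forall a x, dom a x -> {for x, continuous (crd a)};
  continuous_par : forall a y, img a y -> {for y, continuous (par a)};
  chart_cover : forall x, exists a, dom a x;
  smooth_transition : forall a b,
    smooth_on (crd a @` (dom a `&` dom b)) (crd b \o par a) }.

Section tensors.
Context {R : realType} {n : nat}.
Implicit Type M : manifold R n.

Definition transition M (a b : chart M) (x : M) : 'M[R]_n :=
  'J (crd b \o par a) (crd a x).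

(* A tangent vector at x: its coordinate vectors in the charts around x (the
   values in the other charts are irrelevant). *)
Definition tangent M (x : M) (v : chart M -> 'rV[R]_n) : Prop :=
  forall a b, dom a x -> dom b x -> v b = v a *m transition a b x.

Record endo_field M := EndoField {
  endo :> chart M -> 'rV[R]_n -> 'M[R]_n;
  smooth_endo : forall a, smooth_on (img a) (endo a);
  endo_transition : forall a b x, dom a x -> dom b x ->
    endo a (crd a x) *m transition a b x =
    transition a b x *m endo b (crd b x) }.

Definition inner k (A : 'M[R]_k) (u v : 'rV[R]_k) : R := (u *m A *m v^T) 0 0.

Record riemannian_metric M := RiemannianMetric {
  gram :> chart M -> 'rV[R]_n -> 'M[R]_n;
  smooth_gram : forall a, smooth_on (img a) (gram a);
  gram_sym : forall a y, img a y -> (gram a y)^T = gram a y;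
  gram_pos : forall a y v, img a y -> v != 0 -> 0 < inner (gram a y) v v;
  gram_transition : forall a b x, dom a x -> dom b x ->
    gram a (crd a x) =
    transition a b x *m gram b (crd b x) *m (transition a b x)^T }.

End tensors.

(** * Linear connections on an open subset of R^k *)

Section connection.
Context {R : realType} {k : nat}.
Local Notation V := 'rV[R]_k.

(* C y i j is the coordinate vector of nabla_{d_i} d_j at y. *)
Implicit Type C : V -> 'I_k -> 'I_k -> V.
Implicit Types X Y Z : V -> V.
(* G y u v is the value at y of a (pseudo-)Riemannian metric on u and v. *)
Implicit Type G : V -> V -> V -> R.

Definition christ C (y u v : V) : V :=
  \sum_(i < k) \sum_(j < k) (u 0 i * v 0 j) *: C y i j.

Definition nabla C X Y (y : V) : V := 'D_(X y) Y y + christ C y (X y) (Y y).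

Definition lie_bracket X Y (y : V) : V := 'D_(X y) Y y - 'D_(Y y) X y.

Record levi_civita (U : set V) G C : Prop := LeviCivita {
  lc_smooth : forall i j, smooth_on U (fun y => C y i j);
  lc_torsion_free : forall X Y, smooth_on U X -> smooth_on U Y ->
    forall y, U y -> nabla C X Y y - nabla C Y X y = lie_bracket X Y y;
  lc_metric : forall X Y Z,
    smooth_on U X -> smooth_on U Y -> smooth_on U Z ->
    forall y, U y -> 'D_(X y) (fun z => G z (Y z) (Z z)) y =
      G y (nabla C X Y y) (Z y) + G y (Y y) (nabla C X Z y) }.

Definition curvature_field C X Y Z (y : V) : V :=
  nabla C X (nabla C Y Z) y - nabla C Y (nabla C X Z) y
  - nabla C (lie_bracket X Y) Z y.

(* R(u,v)w at y; by tensoriality any local extensions of u, v, w may be used,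
   here the ones with constant coordinates. *)
Definition curvature C (y u v w : V) : V :=
  curvature_field C (cst u) (cst v) (cst w) y.

(* The covariant derivative of the vector field v along the curve x. *)
Definition cov_along C (x v : R -> V) (t : R) : V :=
  derive1 v t + christ C (x t) (derive1 x t) (v t).

Definition acceleration C (x : R -> V) : R -> V := cov_along C x (derive1 x).

End connection.

(** * Embedded submanifolds of R^N with the metric induced by G *)

Section submanifold.
Context {R : realType} {N : nat} (k : nat) (S : set 'rV[R]_N).
Variable G : 'rV[R]_N -> 'rV[R]_N -> 'rV[R]_N -> R.

(* psi : W -> S is a regular local parametrization of the k-dimensional
   submanifold S: an immersion and a homeomorphism onto an open subset of S. *)
Record local_param (W : set 'rV[R]_k) (psi : 'rV[R]_k -> 'rV[R]_N) : Prop :=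
  LocalParam {
    lp_open : open W;
    lp_smooth : smooth_on W psi;
    lp_immersion : forall w, W w -> row_free ('J psi w);
    lp_inj : forall w w', W w -> W w' -> psi w = psi w' -> w = w';
    lp_homeo : forall O, open O -> O `<=` W ->
      exists2 V, open V & psi @` O = S `&` V }.

Definition induced_metric (psi : 'rV[R]_k -> 'rV[R]_N) (w u v : 'rV[R]_k) : R :=
  G (psi w) (u *m 'J psi w) (v *m 'J psi w).

(* A, a vector of R^N, is the covariant acceleration at time t of the curve Gam
   in S, for the Levi-Civita connection of the induced metric: read Gam in a
   local parametrization as a curve c, take the acceleration of c there, and
   push it forward. *)
Definition induced_acceleration (Gam : R -> 'rV[R]_N) (t : R)
    (A : 'rV[R]_N) : Prop :=
  exists W psi C (J : set R) (c : R -> 'rV[R]_k),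
    [/\ local_param W psi, levi_civita W (induced_metric psi) C,
        [/\ open J, J t & smooth_curve J c],
        forall s, J s -> W (c s) /\ psi (c s) = Gam s &
        A = acceleration C c t *m 'J psi (c t)].

End submanifold.

(** * Para-Kaehler-Norden manifolds *)

Section para_kahler_norden.
Context {R : realType} {m : nat}.

(* C is the Levi-Civita connection of g in every chart.  The transformation rule
   of its coefficients is not a field: it follows from uniqueness. *)
Record para_kahler_norden (M : manifold R (2 * m)) (phi : endo_field M)
    (g : riemannian_metric M)
    (C : chart M -> 'rV[R]_(2 * m) -> 'I_(2 * m) -> 'I_(2 * m) ->
         'rV[R]_(2 * m)) : Prop := ParaKahlerNorden {
  pkn_levi_civita : forall a, levi_civita (img a) (fun y => inner (g a y)) (C a);
  pkn_invol : forall a y, img a y -> phi a y *m phi a y = 1%:M;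
  pkn_neq_id : ~ (forall a y, img a y -> phi a y = 1%:M);
  pkn_neq_opp_id : ~ (forall a y, img a y -> phi a y = - 1%:M);
  pkn_rank_plus : forall a y, img a y -> \rank (eigenspace (phi a y) 1) = m;
  pkn_rank_minus : forall a y, img a y -> \rank (eigenspace (phi a y) (-1)) = m;
  pkn_pure : forall a y u v, img a y ->
    inner (g a y) (u *m phi a y) v = inner (g a y) u (v *m phi a y);
  pkn_parallel : forall a X Y, smooth_on (img a) X -> smooth_on (img a) Y ->
    forall y, img a y ->
      nabla (C a) X (fun z => Y z *m phi a z) y = nabla (C a) X Y y *m phi a y }.

End para_kahler_norden.

(** * The tangent bundle in the coordinates p = (y, v) induced by a chart *)

Section tangent_bundle.
Context {R : realType} {n : nat}.
Variable C : 'rV[R]_n -> 'I_n -> 'I_n -> 'rV[R]_n.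
Variables g phi : 'rV[R]_n -> 'M[R]_n.
Implicit Types (p w : 'rV[R]_(n + n)) (X Y : 'rV[R]_n).

Definition hlift p X : 'rV[R]_(n + n) :=
  row_mx X (- christ C (lsubmx p) X (rsubmx p)).

Definition vlift X : 'rV[R]_(n + n) := row_mx 0 X.

(* w = hlift p (hpart w) + vlift (vpart p w); see [hv_decomposition] below *)
Definition hpart w : 'rV[R]_n := lsubmx w.

Definition vpart p w : 'rV[R]_n :=
  rsubmx w + christ C (lsubmx p) (lsubmx w) (rsubmx p).

Definition sasaki p w w' : R :=
  inner (g (lsubmx p)) (hpart w) (hpart w') +
  inner (g (lsubmx p)) (vpart p w) (vpart p w' *m phi (lsubmx p)).

Definition hlift_endo (F : 'rV[R]_n -> 'M[R]_n) p w : 'rV[R]_(n + n) :=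
  hlift p (hpart w *m F (lsubmx p)) + vlift (vpart p w *m F (lsubmx p)).

(* U is the image of the chart of the base *)
Definition unit_bundle (U : set 'rV[R]_n) : set 'rV[R]_(n + n) :=
  [set p | U (lsubmx p) /\
    inner (g (lsubmx p)) (rsubmx p) (rsubmx p *m phi (lsubmx p)) = 1].

Lemma hv_decomposition p w : w = hlift p (hpart w) + vlift (vpart p w).
Proof.
by rewrite /hlift /vlift /hpart /vpart add_row_mx addr0 addrCA addNr addr0
  hsubmxK.
Qed.

Lemma hpart_hlift p X : hpart (hlift p X) = X.
Proof. by rewrite /hpart /hlift row_mxKl. Qed.

Lemma vpart_hlift p X : vpart p (hlift p X) = 0.
Proof. by rewrite /vpart /hlift row_mxKl row_mxKr addNr. Qed.

Lemma hpart_vlift X : hpart (vlift X) = 0.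
Proof. by rewrite /hpart /vlift row_mxKl. Qed.

Lemma vpart_vlift p X : vpart p (vlift X) = X.
Proof.
rewrite /vpart /vlift row_mxKl row_mxKr /christ big1 ?addr0 // => i _.
by rewrite big1 // => j _; rewrite mxE mul0r scale0r.
Qed.

Let inner0l (A : 'M[R]_n) u : inner A 0 u = 0.
Proof. by rewrite /inner !mul0mx mxE. Qed.

Let inner0r (A : 'M[R]_n) u : inner A u 0 = 0.
Proof. by rewrite /inner trmx0 mulmx0 mxE. Qed.

Lemma sasaki_hh p X Y :
  sasaki p (hlift p X) (hlift p Y) = inner (g (lsubmx p)) X Y.
Proof. by rewrite /sasaki !hpart_hlift !vpart_hlift inner0l addr0. Qed.

Lemma sasaki_hv p X Y : sasaki p (hlift p X) (vlift Y) = 0.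
Proof.
by rewrite /sasaki hpart_vlift vpart_hlift inner0l inner0r addr0.
Qed.

Lemma sasaki_vv p X Y : sasaki p (vlift X) (vlift Y) =
  inner (g (lsubmx p)) X (Y *m phi (lsubmx p)).
Proof. by rewrite /sasaki !hpart_vlift !vpart_vlift inner0l add0r. Qed.

Lemma hlift_endo_h F p X :
  hlift_endo F p (hlift p X) = hlift p (X *m F (lsubmx p)).
Proof.
by rewrite /hlift_endo hpart_hlift vpart_hlift mul0mx /vlift row_mx0 addr0.
Qed.

Lemma hlift_endo_v F p X :
  hlift_endo F p (vlift X) = vlift (X *m F (lsubmx p)).
Proof.
rewrite /hlift_endo hpart_vlift vpart_vlift mul0mx /hlift /christ big1.
  by rewrite oppr0 row_mx0 add0r.
by move=> i _; rewrite big1 // => j _; rewrite mxE mul0r scale0r.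
Qed.

End tangent_bundle.

(** * Curves in the tangent bundle *)

Section curves.
Context {R : realType} {n : nat}.

Definition crd_curve (M : manifold R n) (gam : R -> M) (a : chart M) :
  R -> 'rV[R]_n := fun t => crd a (gam t).

(* xi t a is the coordinate vector of xi(t) in the chart a *)
Definition crd_field (M : manifold R n) (xi : R -> chart M -> 'rV[R]_n)
  (a : chart M) : R -> 'rV[R]_n := fun t => xi t a.

Definition crd_bundle_curve (M : manifold R n) (gam : R -> M)
    (xi : R -> chart M -> 'rV[R]_n) (a : chart M) : R -> 'rV[R]_(n + n) :=
  fun t => row_mx (crd_curve gam a t) (crd_field xi a t).

Record bundle_curve (M : manifold R n) (I : set R) (gam : R -> M)
    (xi : R -> chart M -> 'rV[R]_n) : Prop := BundleCurve {
  bc_continuous : forall t, I t -> {for t, continuous gam};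
  bc_smooth : forall a,
    smooth_curve (I `&` gam @^-1` dom a) (crd_curve gam a);
  bc_tangent : forall t, I t -> tangent (gam t) (xi t);
  bc_field_smooth : forall a,
    smooth_curve (I `&` gam @^-1` dom a) (crd_field xi a) }.

(* An equality of tangent vectors is required in every chart around the point. *)
Definition HF_planar (M : manifold R n) (phi : endo_field M)
    (g : riemannian_metric M)
    (C : chart M -> 'rV[R]_n -> 'I_n -> 'I_n -> 'rV[R]_n) (F : endo_field M)
    (I : set R) (gam : R -> M) (xi : R -> chart M -> 'rV[R]_n) : Prop :=
  exists rho1 rho2 : R -> R, forall t a, I t -> dom a (gam t) ->
    let Gam := crd_bundle_curve gam xi a in
    induced_acceleration (n + n).-1
      (unit_bundle (g a) (phi a) (img a)) (sasaki (C a) (g a) (phi a)) Gam t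
      (rho1 t *: derive1 Gam t +
       rho2 t *: hlift_endo (C a) (F a) (Gam t) (derive1 Gam t)).

End curves.

(* Main.v *)
(* The acceleration of a curve for a Levi-Civita connection is determined by the
   Euler-Lagrange expression of the energy.  Computed for the phi-Sasaki metric
   along Gamma = (x, xi), this expression is the product with
   ^H(x'' - R(xi', phi xi) x') + ^V xi'', by the pair symmetry of R and because
   R commutes with phi; hence for the induced metric the acceleration is the part
   of this vector tangent to the unit bundle.  The unit normal is ^V xi, and
   differentiating g(xi, phi xi) = 1 twice gives
   g(xi'', phi xi) = - g(xi', phi xi') = - rho ^+ 2, so the tangential part is
   ^H(x'' - R(xi', phi xi) x') + ^V(xi'' + rho ^+ 2 xi); comparing horizontal
   and vertical parts with rho1 Gamma' + rho2 ^HF Gamma' gives the two equations.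
   Conversely, the acceleration must be shown to exist: the unit bundle is
   parametrized by normalizing vectors with one fixed nonzero entry, and the
   induced metric has a connection by the Koszul formula. *)

Require Import Defs.
From mathcomp Require Import all_boot all_order all_algebra.
From mathcomp Require Import all_classical all_reals all_analysis.
From mathcomp Require Import ring lra.

Set Implicit Arguments.
Unset Strict Implicit.
Unset Printing Implicit Defensive.

Import Order.TTheory GRing.Theory Num.Theory.
Import numFieldNormedType.Exports.

Local Open Scope classical_set_scope.
Local Open Scope ring_scope.

(** * Differentiable maps and directional derivatives *)

(** The vertical part of the phi-Sasaki metric has mixed signature, so nondegeneracy, on which both
    uniqueness of the acceleration and the Koszul formula rest, is not automatic, least of all on a
    hypersurface. On TM it comes from testing a vertical vector v against phi v; on the unit bundle,
    from the normal ^V xi having square 1. The Levi-Civita connection of the phi-Sasaki metric is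
    never written down. Differentiating horizontal and vertical parts separately, covariantly along
    the base, is compatible with the metric because g and phi are parallel, but it has torsion:
    exchanging two directions changes the vertical derivative by the curvature applied to xi. The
    curvature term of the first equation is this torsion, moved to the other slot by pair symmetry.
    The acceleration is specified through an arbitrary parametrization, connection and coordinate
    curve. Its value is therefore computed for all choices at once, which settles the direct
    implication; for the converse one choice must be exhibited, and the same computation then gives
    its value. *)

Section has_deriv.
Context {R : realType}.
Implicit Types E V W : normedModType R.

(** Full differentiability is kept next to the directional value because the chain rule needs it;
    each calculus rule then delivers both at once. *)
Definition has_deriv E W (f : E -> W) (x v : E) (df : W) : Prop :=
  differentiable f x /\ 'D_v f x = df.

Lemma has_derivP E W (f : E -> W) x v :
  differentiable f x -> has_deriv f x v ('D_v f x).
Proof. by []. Qed.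

Lemma has_deriv_eq E W (f : E -> W) x v df df' :
  has_deriv f x v df -> df = df' -> has_deriv f x v df'.
Proof. by move=> ? <-. Qed.

Lemma has_deriv_is_derive E W (f : E -> W) x v df :
  has_deriv f x v df -> is_derive x v f df.
Proof. by case=> df1 <-; apply/derivableP/diff_derivable. Qed.

Lemma is_diff_has_deriv E W (f : E -> W) x v (df : E -> W) :
  is_diff x f df -> has_deriv f x v (df v).
Proof. by move=> fdf; split=> //; rewrite deriveE // diff_val. Qed.

Lemma has_deriv_near E W (f g : E -> W) x v df :
  (\forall y \near x, f y = g y) ->
  has_deriv f x v df -> has_deriv g x v df.
Proof.
move=> fg [fx <-]; split.
  have geq : g \o shift x = cst (g x) + 'd f x +o_ (0 : E) id.
    have /eqaddoP feq := diff_locally fx; apply/eqaddoP => e e0.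
    have /= := feq e e0; have fgx := nbhs_singleton fg.
    have : \forall h \near (0 : E), f (h + x) = g (h + x).
      have /nbhs_ballP[d d0 dfg] := fg; apply/nbhs_ballP; exists d => // h /=.
      rewrite -ball_normE /= sub0r normrN => hd; apply: dfg.
      by rewrite -ball_normE /= opprD addrCA subrr addr0 normrN.
    apply: filter_app2; near=> h => fgh.
    by rewrite !fctE /= fgh fgx.
  have cdf : continuous ('d f x) by exact: diff_continuous.
  by apply/diff_locallyP; rewrite (diff_unique cdf geq).
by rewrite (near_eq_derive v fg).
Unshelve. all: by end_near. Qed.

Lemma has_deriv_on E W (U : set E) (f g : E -> W) x v df : open U -> U x ->
  (forall y, U y -> f y = g y) -> has_deriv f x v df -> has_deriv g x v df.
Proof.
move=> oU Ux fg; apply: has_deriv_near.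
by near do apply: fg; exact: open_nbhs_nbhs.
Unshelve. all: by end_near. Qed.

Lemma derive_on E W (U : set E) (f g : E -> W) x v : open U -> U x ->
  (forall y, U y -> f y = g y) -> 'D_v f x = 'D_v g x.
Proof.
move=> oU Ux fg; apply: near_eq_derive.
near do apply: fg; exact: open_nbhs_nbhs.
Unshelve. all: by end_near. Qed.

Lemma has_deriv_cst E W (w : W) (x v : E) : has_deriv (fun=> w) x v 0.
Proof. exact: (is_diff_has_deriv v (is_diff_cst w x)). Qed.

Lemma has_deriv_id E (x v : E) : has_deriv id x v v.
Proof. exact: (is_diff_has_deriv v (is_diff_id x)). Qed.

Lemma has_derivD E W (f g : E -> W) x v df dg :
  has_deriv f x v df -> has_deriv g x v dg ->
  has_deriv (fun z => f z + g z) x v (df + dg).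
Proof.
move=> [fx <-] [gx <-]; split; first exact: differentiableD.
by rewrite deriveD //; exact: diff_derivable.
Qed.

Lemma has_derivN E W (f : E -> W) x v df :
  has_deriv f x v df -> has_deriv (fun z => - f z) x v (- df).
Proof.
move=> [fx <-]; split; first exact: differentiableN.
by rewrite deriveN //; exact: diff_derivable.
Qed.

Lemma has_derivB E W (f g : E -> W) x v df dg :
  has_deriv f x v df -> has_deriv g x v dg ->
  has_deriv (fun z => f z - g z) x v (df - dg).
Proof. by move=> fx gx; apply: has_derivD => //; exact: has_derivN. Qed.

Lemma has_deriv_sum E W (I : Type) (r : seq I) (P : pred I) (f : I -> E -> W)
    x v df : (forall i, P i -> has_deriv (f i) x v (df i)) ->
  has_deriv (fun z => \sum_(i <- r | P i) f i z) x v (\sum_(i <- r | P i) df i).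
Proof.
move=> fx; elim: r => [|i r IH].
  rewrite big_nil; under eq_fun do rewrite big_nil; exact: has_deriv_cst.
rewrite big_cons; under eq_fun do rewrite big_cons.
by case: ifP => // Pi; apply: has_derivD => //; exact: fx.
Qed.

Lemma has_derivM E (f g : E -> R) x v df dg :
  has_deriv f x v df -> has_deriv g x v dg ->
  has_deriv (fun z => f z * g z) x v (df * g x + f x * dg).
Proof.
move=> [fx <-] [gx <-]; split; first exact: differentiableM.
rewrite (_ : (fun z => f z * g z) = f * g) //.
rewrite deriveM; [|exact: diff_derivable|exact: diff_derivable].
by rewrite /GRing.scale /= addrC mulrC [_ * g x]mulrC mulrC.
Qed.

Lemma has_derivV E (f : E -> R) x v df : f x != 0 ->
  has_deriv f x v df -> has_deriv (fun z => (f z)^-1) x v (- (f x) ^- 2 * df).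
Proof.
move=> f0 [fx <-]; split; first exact: differentiableV.
by rewrite deriveV //; exact: diff_derivable.
Qed.

Lemma has_deriv_comp E V W (f : V -> W) (c : E -> V) x v dc :
  differentiable f (c x) -> has_deriv c x v dc ->
  has_deriv (fun z => f (c z)) x v ('D_dc f (c x)).
Proof.
move=> fx [cx <-]; split; first exact: differentiable_comp.
rewrite deriveE; last exact: differentiable_comp.
by rewrite diff_comp // [RHS]deriveE // [in RHS]deriveE.
Qed.

Lemma has_deriv_linear E V W (L : {linear V -> W}) (f : E -> V) x v df :
  continuous L -> has_deriv f x v df -> has_deriv (fun z => L (f z)) x v (L df).
Proof.
move=> cL fx; apply: has_deriv_eq.
  apply: has_deriv_comp fx; exact: linear_differentiable.
by rewrite deriveE ?diff_lin //; exact: linear_differentiable.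
Qed.

Lemma has_deriv_mxP E m n (f : E -> 'M[R]_(m, n)) x v df :
  has_deriv f x v df <->
  forall i j, has_deriv (fun z => f z i j) x v (df i j).
Proof.
split=> [[fx <-] i j|fx].
  have [df0 eqd] : has_deriv f x v ('D_v f x) by [].
  split.
    apply: (@differentiable_comp _ _ _ _ f
      (fun A : 'M[R]_(m, n) => A i j : R)) => //.
    exact: differentiable_coord.
  by rewrite derive_mx ?mxE //; exact: diff_derivable.
have -> : f = (fun z => \sum_i \sum_j f z i j *: delta_mx i j).
  by apply/funext => z; rewrite -matrix_sum_delta.
rewrite (matrix_sum_delta df).
apply: has_deriv_sum => i _; apply: has_deriv_sum => j _.
have [dfij <-] := fx i j; split; first exact: differentiableZl.
rewrite deriveE; last exact: differentiableZl.
by rewrite diffZl // deriveE.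
Qed.

Lemma has_deriv_mulmx E m n p (f : E -> 'M[R]_(m, n)) (g : E -> 'M[R]_(n, p))
    x v df dg :
  has_deriv f x v df -> has_deriv g x v dg ->
  has_deriv (fun z => f z *m g z) x v (df *m g x + f x *m dg).
Proof.
move=> /has_deriv_mxP fx /has_deriv_mxP gx; apply/has_deriv_mxP => i j.
rewrite !mxE -big_split /=; under eq_fun do rewrite mxE.
by apply: has_deriv_sum => k _; apply: has_derivM.
Qed.

Lemma has_deriv_mulmxl E m n p (A : 'M[R]_(m, n)) (g : E -> 'M[R]_(n, p))
    x v dg :
  has_deriv g x v dg -> has_deriv (fun z => A *m g z) x v (A *m dg).
Proof.
move=> gx; apply: has_deriv_eq.
  by apply: has_deriv_mulmx gx; exact: has_deriv_cst.
by rewrite mul0mx add0r.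
Qed.

Lemma has_deriv_scalemx E m n (a : E -> R) (f : E -> 'M[R]_(m, n)) x v da df :
  has_deriv a x v da -> has_deriv f x v df ->
  has_deriv (fun z => a z *: f z) x v (da *: f x + a x *: df).
Proof.
move=> ax /has_deriv_mxP fx; apply/has_deriv_mxP => i j; rewrite !mxE.
by under eq_fun do rewrite mxE; exact: has_derivM.
Qed.

Lemma has_deriv_trmx E m n (f : E -> 'M[R]_(m, n)) x v df :
  has_deriv f x v df -> has_deriv (fun z => (f z)^T) x v df^T.
Proof.
move=> /has_deriv_mxP fx; apply/has_deriv_mxP => i j; rewrite mxE.
by under eq_fun do rewrite mxE.
Qed.

Lemma has_deriv_lsubmx E m n1 n2 (f : E -> 'M[R]_(m, n1 + n2)) x v df :
  has_deriv f x v df -> has_deriv (fun z => lsubmx (f z)) x v (lsubmx df).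
Proof. exact: (has_deriv_linear (@continuous_lsubmx _ _ _ _)). Qed.

Lemma has_deriv_rsubmx E m n1 n2 (f : E -> 'M[R]_(m, n1 + n2)) x v df :
  has_deriv f x v df -> has_deriv (fun z => rsubmx (f z)) x v (rsubmx df).
Proof. exact: (has_deriv_linear (@continuous_rsubmx _ _ _ _)). Qed.

Lemma has_deriv_row_mx E m n1 n2 (f : E -> 'M[R]_(m, n1))
    (g : E -> 'M[R]_(m, n2)) x v df dg :
  has_deriv f x v df -> has_deriv g x v dg ->
  has_deriv (fun z => row_mx (f z) (g z)) x v (row_mx df dg).
Proof.
move=> /has_deriv_mxP fx /has_deriv_mxP gx; apply/has_deriv_mxP => i j.
under eq_fun do rewrite mxE; rewrite mxE; case: (fintype.split j) => k.
  exact: fx.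
exact: gx.
Qed.

Lemma has_deriv_line E (y u : E) : has_deriv (fun s : R => y + s *: u) 0 1 u.
Proof.
apply: has_deriv_eq; first (apply: has_derivD; first exact: has_deriv_cst).
  by apply: (is_diff_has_deriv _ (is_diff_scalel 0 u)).
by rewrite add0r scale1r.
Qed.

Lemma has_deriv_comp_line E W (f : E -> W) y u : differentiable f y ->
  has_deriv (fun s : R => f (y + s *: u)) 0 1 ('D_u f y).
Proof.
move=> fy; have := @has_deriv_comp _ _ _ f (fun s : R => y + s *: u) 0 1 u.
rewrite scale0r addr0; apply=> //; exact: has_deriv_line.
Qed.

End has_deriv.

(** * Symmetry of second derivatives *)

Section schwarz.
Context {R : realType}.
Implicit Type E : normedModType R.

(* Young: [f (y + h u + h v) - f (y + h u) - f (y + h v) + f y], which is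
   symmetric in u and v, is [h ^+ 2 * 'D_v ('D_u f) y] up to o(h ^+ 2). *)
Lemma second_difference E (U : set E) (f : E -> R) y u v : open U -> U y ->
  (forall z, U z -> differentiable f z) -> differentiable ('D_u f) y ->
  forall e : R, 0 < e -> exists2 d : R, 0 < d & forall h : R, 0 < h < d ->
  `|f (y + h *: u + h *: v) - f (y + h *: u) - f (y + h *: v) + f y
    - h ^+ 2 * 'D_v ('D_u f) y| <= e * h ^+ 2.
Proof.
(* With this [M], the norm of s u + w is at most h M for 0 <= s <= h and w = 0 or w = h v. The
   relative error e / (2 M) is then incurred at two points and totals e h. *)
move=> oU Uy df dDu e e0; pose M := `|u| + `|v| + 1.
have M0 : 0 < M by rewrite ltr_wpDl // addr_ge0.
have eM0 : 0 < e / (2 * M) by rewrite divr_gt0 // mulr_gt0.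
have [r r0 rP] : exists2 r : R, 0 < r & forall w, `|w| < r -> U (y + w) /\
    `|'D_u f (y + w) - 'D_u f y - 'd ('D_u f) y w| <= e / (2 * M) * `|w|.
  have /eqaddoP/(_ _ eM0) /= := diff_locally dDu.
  have : \forall w \near (0 : E), U (y + w).
    have /nbhs_ballP[d d0 dU] := open_nbhs_nbhs (conj oU Uy).
    apply/nbhs_ballP; exists d => // h /=.
    rewrite -ball_normE /= sub0r normrN => hd; apply: dU.
    by rewrite -ball_normE /= opprD addNKr normrN.
  move=> /filterI /[apply] /nbhs_ballP[d d0 dP]; exists d => // w wd.
  have [|Uw] := dP w; first by rewrite -ball_normE /= sub0r normrN.
  by rewrite !fctE /= opprD addrA [w + y]addrC => le; split.
exists (r / M) => [|h /andP[h0 hr]]; first by rewrite divr_gt0.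
have small (s : R) w : 0 <= s <= h -> w = 0 \/ w = h *: v ->
    `|s *: u + w| <= h * M.
  move=> /andP[s0 sh] wE; rewrite (le_trans (ler_normD _ _)) // normrZ.
  rewrite ger0_norm // /M !mulrDr -addrA lerD ?ler_wpM2r //.
  case: wE => ->; first by rewrite normr0 addr_ge0 // mulr_ge0 // ltW.
  by rewrite normrZ gtr0_norm // lerDl mulr1 ltW.
have hMr : h * M < r by rewrite -ltr_pdivlMr.
have smallr (s : R) w : 0 <= s <= h -> w = 0 \/ w = h *: v -> `|s *: u + w| < r.
  by move=> sh wE; rewrite (le_lt_trans (small s w sh wE)).
have dline w (s : R) : 0 <= s <= h -> w = 0 \/ w = h *: v ->
    has_deriv (fun s : R => f (y + (s *: u + w))) s 1
      ('D_u f (y + (s *: u + w))).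
  move=> sh wE; have fs : differentiable f (y + (s *: u + w)).
    by apply: df; have [] := rP _ (smallr _ _ sh wE).
  apply: (has_deriv_comp (c := fun s : R => y + (s *: u + w))) => //.
  apply: has_deriv_eq; first (apply: has_derivD; first exact: has_deriv_cst).
    apply: has_derivD; last exact: has_deriv_cst.
    exact: (is_diff_has_deriv _ (is_diff_scalel s u)).
  by rewrite add0r addr0 scale1r.
(* The second difference is the increment over [0, h] of [F], the difference of f on two lines
   parallel to u. One use of the mean value theorem leaves 'D_u f at two points, where its
   first-order expansion at y applies. *)
pose F s := f (y + (s *: u + h *: v)) - f (y + (s *: u + 0)).
have dF (s : R) : 0 <= s <= h -> has_deriv F s 1
    ('D_u f (y + (s *: u + h *: v)) - 'D_u f (y + (s *: u + 0))).
  by move=> sh; apply: has_derivB; apply: dline => //; [right|left].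
have [||c cI FE] := @MVT R F
    (fun s => 'D_u f (y + (s *: u + h *: v)) - 'D_u f (y + (s *: u + 0)))
    0 h h0.
- move=> s; rewrite in_itv /= => /andP[s0 sh].
  by apply/has_deriv_is_derive/dF; rewrite !ltW.
- apply: derivable_within_continuous => s; rewrite in_itv /= => sh.
  by have [? _] := dF s sh; exact: diff_derivable.
have {}cI : 0 <= c <= h.
  by move: cI; rewrite in_itv /= => /andP[? ?]; rewrite !ltW.
have -> : f (y + h *: u + h *: v) - f (y + h *: u) - f (y + h *: v) + f y =
    F h - F 0.
  by rewrite /F scale0r !add0r !addr0 !addrA opprB addrA addrAC.
rewrite FE subr0 expr2 -mulrA [X in _ - X]mulrC -mulrBl normrM (gtr0_norm h0).
rewrite mulrA ler_wpM2r //; first exact: ltW.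
have [_ p1] := rP _ (smallr c (h *: v) cI (or_intror erefl)).
have [_ p2] := rP _ (smallr c 0 cI (or_introl erefl)).
have hE : h * 'D_v ('D_u f) y =
    'd ('D_u f) y (c *: u + h *: v) - 'd ('D_u f) y (c *: u + 0).
  rewrite deriveE // addr0 [X in X - _]linearD [X in _ + X - _]linearZ.
  by rewrite addrAC subrr add0r.
rewrite hE.
rewrite (_ : _ - _ = ('D_u f (y + (c *: u + h *: v)) - 'D_u f y -
    'd ('D_u f) y (c *: u + h *: v)) - ('D_u f (y + (c *: u + 0)) - 'D_u f y -
    'd ('D_u f) y (c *: u + 0))); last by ring.
apply: (le_trans (ler_normB _ _)).
have eE : e * h = e / (2 * M) * (h * M) + e / (2 * M) * (h * M).
  by field; rewrite gt_eqF.
rewrite eE; apply: lerD.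
  apply: (le_trans p1); apply: ler_wpM2l; first exact: ltW.
  by apply: small => //; right.
apply: (le_trans p2); apply: ler_wpM2l; first exact: ltW.
  by apply: small => //; left.
Qed.

(** For every e and small h, both mixed derivatives times h ^+ 2 lie within e / 2 * h ^+ 2 of the
    same second difference. *)
Lemma derive_comm E (U : set E) (f : E -> R) y u v : open U -> U y ->
  (forall z, U z -> differentiable f z) ->
  differentiable ('D_u f) y -> differentiable ('D_v f) y ->
  'D_u ('D_v f) y = 'D_v ('D_u f) y.
Proof.
move=> oU Uy df du dv; apply/eqP.
rewrite -subr_eq0 -normr_eq0 eq_le normr_ge0 andbT.
apply/ler_addgt0Pl => e e0; rewrite addr0.
have e20 : 0 < e / 2 by rewrite divr_gt0.
have [d1 d10 P1] := second_difference v oU Uy df du e20.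
have [d2 d20 P2] := second_difference u oU Uy df dv e20.
pose h := Num.min d1 d2 / 2.
have m0 : 0 < Num.min d1 d2 by rewrite lt_min d10.
have h0 : 0 < h by rewrite divr_gt0.
have hm : h < Num.min d1 d2 by rewrite /h; lra.
move: (hm); rewrite lt_min => /andP[h1 h2].
have := P1 h; have := P2 h; rewrite h0 h1 h2 => /(_ isT) q2 /(_ isT) q1.
have hh0 : 0 < h ^+ 2 by rewrite exprn_gt0.
rewrite -(ler_pM2l hh0) -{1}(gtr0_norm hh0) -normrM.
rewrite [X in _ <= X](_ : _ = e / 2 * h ^+ 2 + e / 2 * h ^+ 2); last by field.
apply: le_trans (lerD q1 q2); apply: le_trans (ler_normB _ _).
rewrite [y + h *: v + h *: u]addrAC le_eqVlt; apply/orP; left; apply/eqP.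
move: (f _) (f _) (f _) (f y) ('D_u _ _) ('D_v _ _) (h ^+ 2) => a b c d p q k.
by congr `|_|; ring.
Qed.

Lemma derive_comm_mx E m n (U : set E) (f : E -> 'M[R]_(m, n)) y u v :
  open U -> U y -> (forall z, U z -> differentiable f z) ->
  differentiable ('D_u f) y -> differentiable ('D_v f) y ->
  'D_u ('D_v f) y = 'D_v ('D_u f) y.
Proof.
move=> oU Uy df du dv.
have fij i j z w : U z ->
    has_deriv (fun z => f z i j) z w ('D_w f z i j).
  by move=> /df fz; move: i j; apply/has_deriv_mxP.
have dij w i j : differentiable ('D_w f) y ->
    differentiable (fun z => 'D_w f z i j) y.
  by move=> dw; have /has_deriv_mxP/(_ i j)[] := has_derivP 0 dw.
have ddij w w' i j : differentiable ('D_w f) y ->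
    has_deriv ('D_w (fun z => f z i j)) y w' ('D_w' ('D_w f) y i j).
  move=> dw; have /has_deriv_mxP/(_ i j) := has_derivP w' dw.
  apply: (@has_deriv_on _ _ _ U (fun z => 'D_w f z i j)) => // z Uz.
  by have [_ ->] := fij i j z w Uz.
apply/matrixP => i j.
have [dvij evij] := ddij v u i j dv; have [duij euij] := ddij u v i j du.
apply: (etrans (esym evij)); apply: etrans euij.
apply: (@derive_comm _ U (fun z => f z i j) y u v) => // z Uz.
by have [] := fij i j z 0 Uz.
Qed.

End schwarz.

(** * Smoothness *)

Section diffn.
Context {R : realType}.
Implicit Types E V W : normedModType R.

(* Over all k this is smoothness, both for maps on 'rV[R]_n and for curves
   (E = R); asking for derivatives in all directions v instead of partial
   derivatives makes the closure properties independent of E. *)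
Fixpoint diffn E W k (U : set E) (f : E -> W) : Prop :=
  (forall y, U y -> differentiable f y) /\
  (if k is k'.+1 then forall v, diffn k' U ('D_v f) else True).

Lemma diffn_differentiable E W k (U : set E) (f : E -> W) y :
  diffn k U f -> U y -> differentiable f y.
Proof. by case: k => [|k] [df _]; exact: df. Qed.

Lemma diffn_has_deriv E W k (U : set E) (f : E -> W) y v :
  diffn k U f -> U y -> has_deriv f y v ('D_v f y).
Proof. by move=> df Uy; apply/has_derivP/diffn_differentiable/Uy/df. Qed.

Lemma diffn_derive E W k (U : set E) (f : E -> W) v :
  diffn k.+1 U f -> diffn k U ('D_v f).
Proof. by move=> [_ Df]; exact: Df. Qed.

Lemma diffnS E W k (U : set E) (f : E -> W) : diffn k.+1 U f -> diffn k U f.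
Proof.
elim: k f => [|k IH] f [df Df]; first by split.
by split=> // v; apply: IH; exact: Df.
Qed.

Lemma diffnW E W k (U V : set E) (f : E -> W) :
  V `<=` U -> diffn k U f -> diffn k V f.
Proof.
move=> VU; elim: k f => [|k IH] f [df Df].
  by split=> // y /VU; exact: df.
by split=> [y /VU|v]; [exact: df|apply: IH; exact: Df].
Qed.

Lemma diffn_ext E W k (U : set E) (f g : E -> W) : open U ->
  (forall y, U y -> f y = g y) -> diffn k U f -> diffn k U g.
Proof.
move=> oU; elim: k f g => [|k IH] f g fg [df Df].
  split=> // y Uy.
  by have [] := has_deriv_on oU Uy fg (has_derivP 0 (df _ Uy)).
split=> [y Uy|v].
  by have [] := has_deriv_on oU Uy fg (has_derivP 0 (df _ Uy)).
by apply: IH (Df v) => y Uy; apply: derive_on Uy fg.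
Qed.

(** The pattern of the closure proofs: a formula [Df] for the directional derivatives is exhibited,
    and [Df] has order k by induction. *)
Lemma diffn_S E W k (U : set E) (f : E -> W) (Df : E -> E -> W) : open U ->
  (forall y v, U y -> has_deriv f y v (Df v y)) ->
  (forall v, diffn k U (Df v)) -> diffn k.+1 U f.
Proof.
move=> oU fDf dDf; split=> [y Uy|v]; first by have [] := fDf y 0 Uy.
by apply: diffn_ext (dDf v) => // y Uy; have [] := fDf y v Uy.
Qed.

Lemma diffn_0 E W (U : set E) (f : E -> W) (Df : E -> E -> W) :
  (forall y v, U y -> has_deriv f y v (Df v y)) -> diffn 0 U f.
Proof. by move=> fDf; split=> // y Uy; have [] := fDf y 0 Uy. Qed.

Lemma diffn_cst E W k (U : set E) (w : W) : open U -> diffn k U (fun=> w).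
Proof.
move=> oU; elim: k w => [|k IH] w.
  by apply: (@diffn_0 _ _ _ _ (fun _ _ => 0)) => *; exact: has_deriv_cst.
apply: (@diffn_S _ _ _ _ _ (fun _ _ => 0)) => //.
by move=> *; exact: has_deriv_cst.
Qed.

Lemma diffn_linear E W k (U : set E) (L : {linear E -> W}) : open U ->
  continuous L -> diffn k U L.
Proof.
move=> oU cL.
have dL y v : U y -> has_deriv L y v (L v).
  by move=> _; apply: (has_deriv_linear cL); exact: has_deriv_id.
case: k => [|k]; first by apply: (@diffn_0 _ _ _ _ (fun v _ => L v)).
apply: (@diffn_S _ _ _ _ _ (fun v _ => L v)) => // v; exact: diffn_cst.
Qed.

Lemma diffnD E W k (U : set E) (f g : E -> W) : open U ->
  diffn k U f -> diffn k U g -> diffn k U (fun z => f z + g z).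
Proof.
move=> oU; elim: k f g => [|k IH] f g df dg.
  apply: (@diffn_0 _ _ _ _ (fun v z => 'D_v f z + 'D_v g z)) => y v Uy.
  apply: has_derivD; first exact: diffn_has_deriv df Uy.
  exact: diffn_has_deriv dg Uy.
apply: (@diffn_S _ _ _ _ _ (fun v z => 'D_v f z + 'D_v g z)) => // [y v Uy|v].
  apply: has_derivD; first exact: diffn_has_deriv df Uy.
  exact: diffn_has_deriv dg Uy.
by apply: IH; exact: diffn_derive.
Qed.

Lemma diffn_sum E W k (U : set E) (I : Type) (r : seq I) (P : pred I)
    (f : I -> E -> W) : open U -> (forall i, P i -> diffn k U (f i)) ->
  diffn k U (fun z => \sum_(i <- r | P i) f i z).
Proof.
move=> oU df; elim: r => [|i r IH].
  under eq_fun do rewrite big_nil.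
  exact: diffn_cst.
under eq_fun do rewrite big_cons.
by case: (P i) (df i) => // dfi; apply: diffnD => //; exact: dfi.
Qed.

Lemma has_derivZ E W (a : R) (f : E -> W) x v df :
  has_deriv f x v df -> has_deriv (fun z => a *: f z) x v (a *: df).
Proof.
move=> [fx <-]; split; first exact: differentiableZ.
by rewrite deriveZ //; exact: diff_derivable.
Qed.

Lemma diffnZ E W k (U : set E) (a : R) (f : E -> W) : open U ->
  diffn k U f -> diffn k U (fun z => a *: f z).
Proof.
move=> oU; elim: k f => [|k IH] f df.
  apply: (@diffn_0 _ _ _ _ (fun v z => a *: 'D_v f z)) => y v Uy.
  by apply: has_derivZ; exact: diffn_has_deriv df Uy.
apply: (@diffn_S _ _ _ _ _ (fun v z => a *: 'D_v f z)) => // [y v Uy|v].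
  by apply: has_derivZ; exact: diffn_has_deriv df Uy.
by apply: IH; exact: diffn_derive.
Qed.

Lemma diffnM E k (U : set E) (f g : E -> R) : open U ->
  diffn k U f -> diffn k U g -> diffn k U (fun z => f z * g z).
Proof.
move=> oU; pose D (f g : E -> R) v z := 'D_v f z * g z + f z * 'D_v g z.
have fDf k' (f' g' : E -> R) y v : diffn k' U f' -> diffn k' U g' -> U y ->
    has_deriv (fun z => f' z * g' z) y v (D f' g' v y).
  move=> df dg Uy.
  apply: has_derivM; first exact: diffn_has_deriv df Uy.
  exact: diffn_has_deriv dg Uy.
elim: k f g => [|k IH] f g df dg.
  by apply: (@diffn_0 _ _ _ _ (D f g)) => y v; exact: fDf df dg.
apply: (@diffn_S _ _ _ _ _ (D f g)) => // [y v|v]; first exact: fDf df dg.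
apply: diffnD => //; apply: IH; do ?exact: diffnS; exact: diffn_derive.
Qed.

Lemma diffn_prod E k (U : set E) (I : Type) (r : seq I) (f : I -> E -> R) :
  open U -> (forall i, diffn k U (f i)) ->
  diffn k U (fun z => \prod_(i <- r) f i z).
Proof.
move=> oU df; elim: r => [|i r IH].
  under eq_fun do rewrite big_nil.
  exact: diffn_cst.
by under eq_fun do rewrite big_cons; exact: diffnM.
Qed.

Lemma diffnV E k (U : set E) (f : E -> R) : open U ->
  (forall y, U y -> f y != 0) -> diffn k U f -> diffn k U (fun z => (f z)^-1).
Proof.
(* The derivative is written as a product that contains 1 / f itself, so that the induction
   hypothesis and the product rule apply to it. *)
move=> oU f0; pose D v z := (-1) * ((f z)^-1 * (f z)^-1) * 'D_v f z.
have fDf k' y v : diffn k' U f -> U y ->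
    has_deriv (fun z => (f z)^-1) y v (D v y).
  move=> df Uy; apply: has_deriv_eq.
    by apply: has_derivV (f0 _ Uy) _; exact: diffn_has_deriv df Uy.
  by rewrite /D -invfM -expr2 mulN1r.
elim: k => [|k IH] df.
  by apply: (@diffn_0 _ _ _ _ D) => y v; exact: fDf df.
apply: (@diffn_S _ _ _ _ _ D) => // [y v|v]; first exact: fDf df.
have dV := IH (diffnS df).
by do ![apply: diffnM => //]; [exact: diffn_cst|exact: diffn_derive].
Qed.

Lemma diffn_rsqrt E k (U : set E) (f : E -> R) : open U ->
  (forall y, U y -> 0 < f y) -> diffn k U f ->
  diffn k U (fun z => (Num.sqrt (f z))^-1).
Proof.
move=> oU f0; pose r z := (Num.sqrt (f z))^-1.
pose D v z := (- 2^-1) * (r z * (r z * r z)) * 'D_v f z.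
have fDf k' y v : diffn k' U f -> U y -> has_deriv r y v (D v y).
  move=> df Uy; have fy := f0 _ Uy.
  have sy : 0 < Num.sqrt (f y) by rewrite sqrtr_gt0.
  have [ds es] := is_derive1_sqrt fy.
  apply: has_deriv_eq.
    apply: has_derivV; first by rewrite gt_eqF.
    apply: has_deriv_comp; first exact/derivable1_diffP.
    exact: diffn_has_deriv df Uy.
  have -> : 'D_('D_v f y) Num.sqrt (f y) = 'D_v f y * (2 * Num.sqrt (f y))^-1.
    rewrite deriveE; last exact/derivable1_diffP.
    by rewrite deriv1E // derive1E es.
  by rewrite /D /r; field; rewrite gt_eqF.
elim: k => [|k IH] df.
  by apply: (@diffn_0 _ _ _ _ D) => y v; exact: fDf df.
apply: (@diffn_S _ _ _ _ _ D) => // [y v|v]; first exact: fDf df.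
have dr := IH (diffnS df).
by do ![apply: diffnM => //]; [exact: diffn_cst|exact: diffn_derive].
Qed.

Lemma diffn_mxP E m n k (U : set E) (f : E -> 'M[R]_(m, n)) : open U ->
  diffn k U f <-> forall i j, diffn k U (fun z => f z i j).
Proof.
move=> oU; split=> [|df].
  elim: k f => [|k IH] f df i j.
    apply: (@diffn_0 _ _ _ _ (fun v z => 'D_v f z i j)) => y v Uy.
    by move: i j; apply/has_deriv_mxP; exact: diffn_has_deriv df Uy.
  apply: (@diffn_S _ _ _ _ _ (fun v z => 'D_v f z i j)) => // [y v Uy|v].
    by move: i j; apply/has_deriv_mxP; exact: diffn_has_deriv df Uy.
  by apply: IH; exact: diffn_derive.
pose D v z : 'M[R]_(m, n) := \matrix_(i, j) 'D_v (fun z => f z i j) z.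
have fDf k' (f' : E -> 'M[R]_(m, n)) y v :
    (forall i j, diffn k' U (fun z => f' z i j)) -> U y ->
    has_deriv f' y v (\matrix_(i, j) 'D_v (fun z => f' z i j) y).
  move=> df' Uy; apply/has_deriv_mxP => i j; rewrite mxE.
  exact: diffn_has_deriv (df' i j) Uy.
elim: k f @D df => [|k IH] f D df.
  by apply: (@diffn_0 _ _ _ _ D) => y v; exact: fDf df.
apply: (@diffn_S _ _ _ _ _ D) => // [y v|v]; first exact: fDf df.
apply: IH => i j; rewrite (_ : (fun z => _) = 'D_v (fun z => f z i j)).
  exact: diffn_derive (df i j).
by apply/funext => z; rewrite mxE.
Qed.

Lemma diffn_mulmx E m n p k (U : set E) (f : E -> 'M[R]_(m, n))
    (g : E -> 'M[R]_(n, p)) : open U ->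
  diffn k U f -> diffn k U g -> diffn k U (fun z => f z *m g z).
Proof.
move=> oU /(diffn_mxP _ _ oU) df /(diffn_mxP _ _ oU) dg.
apply/(diffn_mxP _ _ oU) => i j; under eq_fun do rewrite mxE.
by apply: diffn_sum => // l _; exact: diffnM.
Qed.

Lemma diffn_trmx E m n k (U : set E) (f : E -> 'M[R]_(m, n)) : open U ->
  diffn k U f -> diffn k U (fun z => (f z)^T).
Proof.
move=> oU /(diffn_mxP _ _ oU) df; apply/(diffn_mxP _ _ oU) => i j.
by under eq_fun do rewrite mxE.
Qed.

Lemma diffn_row_mx E m n1 n2 k (U : set E) (f : E -> 'M[R]_(m, n1))
    (g : E -> 'M[R]_(m, n2)) : open U ->
  diffn k U f -> diffn k U g -> diffn k U (fun z => row_mx (f z) (g z)).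
Proof.
move=> oU /(diffn_mxP _ _ oU) df /(diffn_mxP _ _ oU) dg.
apply/(diffn_mxP _ _ oU) => i j; under eq_fun do rewrite mxE.
by case: (fintype.split j).
Qed.

Lemma diffn_lsubmx E m n1 n2 k (U : set E) (f : E -> 'M[R]_(m, n1 + n2)) :
  open U -> diffn k U f -> diffn k U (fun z => lsubmx (f z)).
Proof.
move=> oU /(diffn_mxP _ _ oU) df; apply/(diffn_mxP _ _ oU) => i j.
by under eq_fun do rewrite mxE.
Qed.

Lemma diffn_rsubmx E m n1 n2 k (U : set E) (f : E -> 'M[R]_(m, n1 + n2)) :
  open U -> diffn k U f -> diffn k U (fun z => rsubmx (f z)).
Proof.
move=> oU /(diffn_mxP _ _ oU) df; apply/(diffn_mxP _ _ oU) => i j.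
by under eq_fun do rewrite mxE.
Qed.

Lemma diffn_det E n k (U : set E) (A : E -> 'M[R]_n) : open U ->
  diffn k U A -> diffn k U (fun z => \det (A z)).
Proof.
move=> oU /(diffn_mxP _ _ oU) dA; rewrite /determinant.
apply: diffn_sum => // s _; apply: diffnM => //; first exact: diffn_cst.
exact: diffn_prod.
Qed.

Lemma diffn_invmx E n k (U : set E) (A : E -> 'M[R]_n) : open U ->
  (forall y, U y -> A y \in unitmx) -> diffn k U A ->
  diffn k U (fun z => invmx (A z)).
Proof.
move=> oU uA dA; have detA y : U y -> \det (A y) != 0.
  by move=> /uA; rewrite unitmxE unitfE.
apply/(diffn_mxP _ _ oU) => i j.
apply: (@diffn_ext _ _ _ _
  (fun z => (\det (A z))^-1 * cofactor (A z) j i)) => //.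
  by move=> y /uA uAy; rewrite /invmx uAy !mxE.
apply: diffnM => //; first by apply: diffnV => //; exact: diffn_det.
rewrite /cofactor; apply: diffnM => //; first exact: diffn_cst.
apply: diffn_det => //; apply/(diffn_mxP _ _ oU) => i' j'.
under eq_fun do rewrite !mxE.
by move: dA => /(diffn_mxP _ _ oU).
Qed.

Lemma derive_rV n W (f : 'rV[R]_n -> W) y u : differentiable f y ->
  'D_u f y = \sum_i u 0 i *: 'D_(delta_mx 0 i) f y.
Proof.
move=> df; rewrite deriveE // [in LHS](row_sum_delta u) linear_sum.
by apply: eq_bigr => i _; rewrite linearZ deriveE.
Qed.

(** The induction on k keeps f general, since the chain rule replaces f by its partial
    derivatives. *)
Lemma diffn_comp E n k (V : set 'rV[R]_n) (U : set E) (f : 'rV[R]_n -> R)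
    (c : E -> 'rV[R]_n) : open U -> (forall z, U z -> V (c z)) ->
  diffn k V f -> diffn k U c -> diffn k U (fun z => f (c z)).
Proof.
move=> oU cV.
pose D (f : 'rV[R]_n -> R) v z :=
  \sum_i ('D_v c z) 0 i * 'D_(delta_mx 0 i) f (c z).
have fDf k' (g : 'rV[R]_n -> R) y v : diffn k' V g -> diffn k' U c -> U y ->
    has_deriv (fun z => g (c z)) y v (D g v y).
  move=> dg dc Uy; have Vy := cV _ Uy.
  apply: has_deriv_eq.
    apply: has_deriv_comp (diffn_differentiable dg Vy) _.
    exact: diffn_has_deriv dc Uy.
  by rewrite derive_rV //; exact: diffn_differentiable dg Vy.
elim: k f => [|k IH] f df dc.
  by apply: (@diffn_0 _ _ _ _ (D f)) => y v; exact: fDf df dc.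
apply: (@diffn_S _ _ _ _ _ (D f)) => // [y v|v]; first exact: fDf df dc.
apply: diffn_sum => // i _; apply: diffnM => //.
  by case: dc => _ /(_ v)/(diffn_mxP _ _ oU).
apply: (IH ('D_(delta_mx 0 i) f)); last exact: diffnS dc.
exact: (diffn_derive (delta_mx 0 i) df).
Qed.

Lemma diffn_comp_mx E n p q k (V : set 'rV[R]_n) (U : set E)
    (f : 'rV[R]_n -> 'M[R]_(p, q)) (c : E -> 'rV[R]_n) : open V -> open U ->
  (forall z, U z -> V (c z)) ->
  diffn k V f -> diffn k U c -> diffn k U (fun z => f (c z)).
Proof.
move=> oV oU cV /(diffn_mxP _ _ oV) df dc; apply/(diffn_mxP _ _ oU) => i j.
exact: (@diffn_comp _ _ _ V U (fun z => f z i j)).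
Qed.

Lemma smooth_on_diffn n W k (U : set 'rV[R]_n) (f : 'rV[R]_n -> W) : open U ->
  smooth_on U f -> diffn k U f.
Proof.
(* At order 0, [Ck] asks for continuity and [diffn] for differentiability; hence the shift by
   one. *)
move=> oU /(_ k.+1); elim: k f => [|k IH] f [df Df]; first by split.
apply: (@diffn_S _ _ _ _ f
  (fun v z => \sum_i v 0 i *: 'D_(delta_mx 0 i) f z)) => // [y v Uy|v].
  by split; [exact: df|apply: derive_rV; exact: df].
by apply: diffn_sum => // i _; apply: diffnZ => //; exact: IH (Df i).
Qed.

Lemma diffn_smooth_on n W (U : set 'rV[R]_n) (f : 'rV[R]_n -> W) :
  (forall k, diffn k U f) -> smooth_on U f.
Proof.
move=> df k; move: (df k); elim: k f {df} => [|k IH] f [df Df].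
  by move=> y Uy; apply/differentiable_continuous/df.
by split=> // i; apply: IH; exact: Df.
Qed.

Lemma smooth_curve_diffn W k (J : set R) (c : R -> W) : open J ->
  smooth_curve J c -> diffn k J c.
Proof.
move=> oJ; elim: k c => [|k IH] c sc.
  by split=> // t Jt; apply/derivable1_diffP/(sc 0%N).
apply: (@diffn_S _ _ _ _ c (fun v z => v *: derive1 c z)) => // [t v Jt|v].
  have dc : derivable c t 1 by exact: (sc 0%N).
  split; first exact/derivable1_diffP.
  by rewrite deriveE ?deriv1E //; exact/derivable1_diffP.
by apply: diffnZ => //; apply: IH => l t Jt; rewrite -derive1Sn; exact: sc.
Qed.

Lemma diffn_smooth_curve W (J : set R) (c : R -> W) :
  (forall k, diffn k J c) -> smooth_curve J c.
Proof.
move=> dc k t Jt; move: (dc k); elim: k c {dc} => [|k IH] c [dc Dc].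
  exact/derivable1_diffP/dc.
rewrite derive1Sn; apply: IH.
rewrite (_ : derive1 c = 'D_1 c) //; first exact: Dc.
by apply/funext => s; rewrite derive1E.
Qed.

Lemma smooth_curve_has_deriv W (J : set R) (c : R -> W) t :
  smooth_curve J c -> J t -> has_deriv c t 1 (derive1 c t).
Proof.
move=> sc Jt; rewrite derive1E; apply: has_derivP.
exact/derivable1_diffP/(sc 0%N).
Qed.

Lemma smooth_curve_derive1 W (J : set R) (c : R -> W) :
  smooth_curve J c -> smooth_curve J (derive1 c).
Proof. by move=> sc k t Jt; rewrite -derive1Sn; exact: sc. Qed.

End diffn.

(** * Levi-Civita connections and curvature *)

Section matrix_entries.
Context {V : zmodType} {m n : nat}.
Implicit Types A B : 'M[V]_(m, n).

Lemma mx_addE A B i j : (A + B) i j = A i j + B i j.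
Proof. by rewrite mxE. Qed.

Lemma mx_oppE A i j : (- A) i j = - A i j.
Proof. by rewrite mxE. Qed.

Lemma mx_trD A B : (A + B)^T = A^T + B^T.
Proof. exact: raddfD. Qed.

Lemma mx_trN A : (- A)^T = - A^T.
Proof. exact: raddfN. Qed.

Lemma mx_zeroE i j : (0 : 'M[V]_(m, n)) i j = 0.
Proof. by rewrite mxE. Qed.

End matrix_entries.

(* Derivatives are generalized first because matching against them makes
   unification unfold limits. *)
Ltac generalize_derive :=
  repeat match goal with |- context [derive ?f ?y ?v] =>
    let D := fresh "D" in generalize (derive f y v) => D end.
Ltac mx_expand :=
  rewrite ?(mulmxDl, mulmxDr, mulmxBl, mulmxBr, mulmxN, mulNmx, mulmxA, mulmx0,
    mul0mx).
Ltac mx_linear :=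
  generalize_derive; mx_expand;
  apply/matrixP => ? ?; rewrite ?(mx_addE, mx_oppE, mx_zeroE); ring.

Lemma scalar_rV (R : realType) (n : nat) (f : 'rV[R]_n -> R) u :
  scalar f -> f u = \sum_i u 0 i * f (delta_mx 0 i).
Proof.
move=> fl; have f0 : f 0 = 0.
  by have := fl (-1) 0 0; rewrite scaler0 addr0 mulN1r addNr.
rewrite {1}(row_sum_delta u); elim: (index_enum _) => [|i r IH].
  by rewrite !big_nil f0.
by rewrite !big_cons fl IH.
Qed.

Section inner.
Context {R : realType} {k : nat}.
Implicit Types (A B : 'M[R]_k) (u v w : 'rV[R]_k).

Lemma innerDl A u v w : inner A (u + v) w = inner A u w + inner A v w.
Proof. by rewrite /inner !mulmxDl mxE. Qed.

Lemma innerDr A u v w : inner A u (v + w) = inner A u v + inner A u w.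
Proof. by rewrite /inner linearD mulmxDr mxE. Qed.

Lemma innerNl A u v : inner A (- u) v = - inner A u v.
Proof. by rewrite /inner !mulNmx mxE. Qed.

Lemma inner0l A v : inner A 0 v = 0.
Proof. by rewrite /inner !mul0mx mxE. Qed.

Lemma inner0r A u : inner A u 0 = 0.
Proof. by rewrite /inner trmx0 mulmx0 mxE. Qed.

Lemma innerBl A u v w : inner A (u - v) w = inner A u w - inner A v w.
Proof. by rewrite innerDl innerNl. Qed.

Lemma innerZl A a u v : inner A (a *: u) v = a * inner A u v.
Proof. by rewrite /inner -!scalemxAl mxE. Qed.

Lemma innerZr A a u v : inner A u (a *: v) = a * inner A u v.
Proof. by rewrite /inner linearZ -scalemxAr mxE. Qed.

Lemma inner_addm A B u v : inner (A + B) u v = inner A u v + inner B u v.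
Proof. by rewrite /inner mulmxDr mulmxDl mxE. Qed.

Lemma inner_mull A B u v : inner (B *m A) u v = inner A (u *m B) v.
Proof. by rewrite /inner !mulmxA. Qed.

Lemma inner_mulr A B u v : inner (A *m B^T) u v = inner A u (v *m B).
Proof. by rewrite /inner trmx_mul !mulmxA. Qed.

Lemma inner_tr A u v : inner A^T u v = inner A v u.
Proof.
rewrite /inner -[RHS](mxE trmx_key (fun i j => (v *m A *m u^T) j i)).
by rewrite -[matrix_of_fun _ _]/((v *m A *m u^T)^T) !trmx_mul trmxK mulmxA.
Qed.

Lemma inner_sym A u v : A^T = A -> inner A u v = inner A v u.
Proof. by move=> At; rewrite -{1}At inner_tr. Qed.

Lemma inner_delta A i j : inner A (delta_mx 0 i) (delta_mx 0 j) = A i j.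
Proof. by rewrite /inner -rowE trmx_delta -colE !mxE. Qed.

Lemma inner_inj A B : (forall u v, inner A u v = inner B u v) -> A = B.
Proof. by move=> AB; apply/matrixP => i j; rewrite -!inner_delta AB. Qed.

Lemma inner_bilinear (f : 'rV[R]_k -> 'rV[R]_k -> R) :
  (forall v, scalar (f^~ v)) -> (forall u, scalar (f u)) ->
  f = inner (\matrix_(i, j) f (delta_mx 0 i) (delta_mx 0 j)).
Proof.
move=> fl fr; apply/funext => u; apply/funext => v.
rewrite (scalar_rV u (fl v)) /inner mxE.
under eq_bigr => i _ do rewrite (scalar_rV v (fr _)) mulr_sumr.
rewrite exchange_big; apply: eq_bigr => j _; rewrite !mxE mulr_suml.
by apply: eq_bigr => i _; rewrite !mxE; ring.
Qed.

Lemma has_deriv_inner (E : normedModType R) (A : E -> 'M[R]_k)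
    (u v : E -> 'rV[R]_k) x d dA du dv :
  has_deriv A x d dA -> has_deriv u x d du -> has_deriv v x d dv ->
  has_deriv (fun z => inner (A z) (u z) (v z)) x d
    (inner dA (u x) (v x) + inner (A x) du (v x) + inner (A x) (u x) dv).
Proof.
move=> Ax ux vx; have /has_deriv_mxP/(_ 0 0) :=
  has_deriv_mulmx (has_deriv_mulmx ux Ax) (has_deriv_trmx vx).
move=> /has_deriv_eq; apply.
by rewrite /inner mulmxDl !mxE; ring.
Qed.

End inner.

Ltac generalize_inner :=
  repeat match goal with |- context [inner ?A ?u ?v] =>
    let r := fresh "r" in generalize (inner A u v) => r end.

Section connection_matrix.
Context {R : realType} {k : nat}.
Implicit Type C : 'rV[R]_k -> 'I_k -> 'I_k -> 'rV[R]_k.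

(** The connection form evaluated at u, acting on row vectors from the right; identities for the
    metric, for phi and for the curvature become matrix identities. *)
Definition conn C (y u : 'rV[R]_k) : 'M[R]_k :=
  \matrix_i christ C y u (delta_mx 0 i).

Lemma christE C y u v : christ C y u v = v *m conn C y u.
Proof.
have cE w : christ C y u w = \sum_j w 0 j *: (\sum_i u 0 i *: C y i j).
  rewrite /christ exchange_big; apply: eq_bigr => j _.
  by rewrite scaler_sumr; apply: eq_bigr => i _; rewrite scalerA mulrC.
rewrite cE mulmx_sum_row; apply: eq_bigr => j _; congr (_ *: _).
rewrite rowK cE [RHS](bigD1 j) //= [X in _ + X]big1 => [|i ij]; last first.
  by rewrite mxE (negPf ij) andbF scale0r.
by rewrite mxE !eqxx scale1r addr0.
Qed.

Lemma connE C y u : conn C y u = \sum_i u 0 i *: conn C y (delta_mx 0 i).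
Proof.
have cE w j : christ C y w (delta_mx 0 j) = \sum_i w 0 i *: C y i j.
  rewrite /christ; apply: eq_bigr => i _; rewrite (bigD1 j) //= big1 => [|l lj].
    by rewrite mxE !eqxx mulr1 addr0.
  by rewrite mxE (negPf lj) andbF mulr0 scale0r.
apply/row_matrixP => j; rewrite linear_sum rowK cE; apply: eq_bigr => i _.
rewrite linearZ /= rowK cE (bigD1 i) //= big1 => [|l li].
  by rewrite mxE !eqxx scale1r addr0.
by rewrite mxE (negPf li) andbF scale0r.
Qed.

Lemma connP C y : linear (conn C y).
Proof.
move=> a u v; rewrite connE [conn C y u]connE [conn C y v]connE scaler_sumr.
rewrite -big_split; apply: eq_bigr => i _ /=.
by rewrite !mxE scalerDl scalerA.
Qed.

Lemma conn0 C y : conn C y 0 = 0.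
Proof. by rewrite connE big1 // => i _; rewrite mxE scale0r. Qed.

Lemma conn_coef C y i j l :
  conn C y (delta_mx 0 i) j l = C y i j 0 l.
Proof.
rewrite mxE /christ summxE (bigD1 i) //= [X in _ + X]big1 => [|i' i'i].
  rewrite addr0 summxE (bigD1 j) //= big1 => [|j' j'j].
    by rewrite !mxE !eqxx mulr1 mul1r addr0.
  by rewrite !mxE (negPf j'j) andbF mulr0 mul0r.
by rewrite summxE big1 // => j' _; rewrite !mxE (negPf i'i) andbF !mul0r.
Qed.

Lemma diffn_conn C U u d : open U ->
  (forall i j, smooth_on U (fun y => C y i j)) ->
  diffn d U (fun y => conn C y u).
Proof.
move=> oU sC; under eq_fun do rewrite connE.
apply: diffn_sum => // i _; apply: diffnZ => //.
apply/(diffn_mxP _ _ oU) => j l; under eq_fun do rewrite conn_coef.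
have /(diffn_mxP _ _ oU) : diffn d U (fun y => C y i j).
  exact: smooth_on_diffn.
exact.
Qed.

Lemma has_deriv_conn C U (E : normedModType R) (x u : E -> 'rV[R]_k) t d dx du :
  open U -> (forall i j, smooth_on U (fun y => C y i j)) -> U (x t) ->
  has_deriv x t d dx -> has_deriv u t d du ->
  has_deriv (fun s => conn C (x s) (u s)) t d
    ('D_dx (fun y => conn C y (u t)) (x t) + conn C (x t) du).
Proof.
move=> oU sC Ux xt ut.
have dc w : differentiable (fun y => conn C y w) (x t).
  by apply: (@diffn_differentiable _ _ _ 0 U) => //; exact: diffn_conn.
under eq_fun do rewrite connE.
apply: has_deriv_eq.
  apply: has_deriv_sum => i _.
  apply: has_deriv_scalemx; first by move: ut => /has_deriv_mxP; exact.
  exact: (has_deriv_comp (dc _) xt).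
rewrite big_split /= -connE addrC; congr (_ + _).
have -> : (fun y => conn C y (u t)) =
    fun y => \sum_i u t 0 i *: conn C y (delta_mx 0 i).
  by apply/funext => y; exact: connE.
have [_ ->] // : has_deriv (fun y => \sum_i u t 0 i *: conn C y (delta_mx 0 i))
    (x t) dx (\sum_i u t 0 i *: 'D_dx (fun y => conn C y (delta_mx 0 i)) (x t)).
by apply: has_deriv_sum => i _; apply/has_derivZ/has_derivP.
Qed.

End connection_matrix.

(** Four Bianchi identities, one for each cyclic shift of the arguments, combine linearly once the
    skew symmetries have normalized their terms. *)
Lemma pair_symmetry (R : realType) (V : Type) (r : V -> V -> V -> V -> R) :
  (forall a b c d, r a b c d = - r b a c d) ->
  (forall a b c d, r a b c d = - r a b d c) ->
  (forall a b c d, r a b c d + r b c a d + r c a b d = 0) ->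
  forall a b c d, r a b c d = r c d a b.
Proof.
move=> r12 r34 rB u v w z.
have := rB u v w z; have := rB v w z u; have := rB w z u v; have := rB z u v w.
rewrite (r34 w z v u) (r12 z v w u) (r34 v z w u) (r34 z u v w).
rewrite (r12 u w z v) (r34 w u z v) (r34 u v z w) (r12 v z u w).
rewrite (r34 z v u w) (r34 v w z u) (r34 w z u v) opprK.
lra.
Qed.

(** * The curvature matrix and its symmetries *)

Section levi_civita_connection.
Context {R : realType} {k : nat} (U : set 'rV[R]_k).
Variables (H : 'rV[R]_k -> 'M[R]_k) (C : 'rV[R]_k -> 'I_k -> 'I_k -> 'rV[R]_k).
Hypothesis oU : open U.
Hypothesis smH : forall d, diffn d U H.
Hypothesis lc : levi_civita U (fun y => inner (H y)) C.

Let smC := lc_smooth lc.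

Let smooth_cst (w : 'rV[R]_k) : smooth_on U (cst w).
Proof. by apply: diffn_smooth_on => d; exact: diffn_cst. Qed.

Lemma nabla_cst y u v : nabla C (cst u) (cst v) y = v *m conn C y u.
Proof. by rewrite /nabla derive_cst add0r christE. Qed.

Let dconn y u v : U y ->
  has_deriv (fun z => conn C z u) y v ('D_v (fun z => conn C z u) y).
Proof.
by move=> Uy; apply: (diffn_has_deriv (k := 0)) Uy; exact: diffn_conn.
Qed.

Lemma conn_sym y u v : U y -> u *m conn C y v = v *m conn C y u.
Proof.
move=> Uy; have := lc_torsion_free lc (smooth_cst u) (smooth_cst v) Uy.
rewrite !nabla_cst /lie_bracket !derive_cst subr0 => /subr0_eq ->; exact: erefl.
Qed.

Lemma derive_gram y u : U y ->
  'D_u H y = conn C y u *m H y + H y *m (conn C y u)^T.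
Proof.
move=> Uy; apply: inner_inj => v w.
have := lc_metric lc (smooth_cst u) (smooth_cst v) (smooth_cst w) Uy.
have [_ -> ] := has_deriv_inner (diffn_has_deriv u (smH 0) Uy)
  (has_deriv_cst v y u) (has_deriv_cst w y u).
rewrite !nabla_cst /= => e; rewrite inner_addm inner_mull inner_mulr -e.
by rewrite inner0l inner0r !addr0.
Qed.

(** The matrix of w |-> R(u, v) w. Row vectors reverse compositions: nabla_u nabla_v contributes
    conn v *m conn u. *)
Definition curv y (u v : 'rV[R]_k) : 'M[R]_k :=
  'D_u (fun z => conn C z v) y - 'D_v (fun z => conn C z u) y
  + conn C y v *m conn C y u - conn C y u *m conn C y v.

Lemma curvatureE y u v w : U y -> curvature C y u v w = w *m curv y u v.
Proof.
move=> Uy; rewrite /curvature /curvature_field.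
have -> : lie_bracket (cst u) (cst v) = cst 0.
  by apply/funext => z; rewrite /lie_bracket !derive_cst subrr.
have nE a b : nabla C (cst a) (nabla C (cst b) (cst w)) y =
    w *m 'D_a (fun z => conn C z b) y + w *m conn C y b *m conn C y a.
  have -> : nabla C (cst b) (cst w) = fun z => w *m conn C z b.
    by apply/funext => z; rewrite nabla_cst.
  rewrite /nabla christE /=; congr (_ + _).
  have [] // := has_deriv_mulmxl w (dconn b a Uy).
rewrite !nE nabla_cst conn0 /curv.
mx_linear.
Qed.

(** The formula of [derive_gram] is differentiated once more; equality of the mixed derivatives of H
    leaves curv *m H + H *m curv^T = 0. *)
Lemma curv_skew y u v w z : U y ->
  inner (H y) (w *m curv y u v) z = - inner (H y) w (z *m curv y u v).
Proof.
move=> Uy; apply/eqP; rewrite -addr_eq0 -inner_mull -inner_mulr -inner_addm.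
suff -> : curv y u v *m H y + H y *m (curv y u v)^T = 0.
  by rewrite /inner mulmx0 mul0mx mxE.
pose DH a z := conn C z a *m H z + H z *m (conn C z a)^T.
have DD a b : 'D_a ('D_b H) y =
    'D_a (fun z => conn C z b) y *m H y + conn C y b *m DH a y
    + (DH a y *m (conn C y b)^T + H y *m ('D_a (fun z => conn C z b) y)^T).
  have dc := dconn b a Uy.
  have dH : has_deriv H y a (DH a y).
    by apply: has_deriv_eq (diffn_has_deriv a (smH 0) Uy) _; exact: derive_gram.
  apply: (etrans (derive_on a oU Uy (fun z => @derive_gram z b))).
  by have [] := has_derivD (has_deriv_mulmx dc dH)
    (has_deriv_mulmx dH (has_deriv_trmx dc)).
have e : 'D_u ('D_v H) y = 'D_v ('D_u H) y.
  apply: (derive_comm_mx oU Uy).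
  - by move=> p Up; exact: diffn_differentiable (smH 0) Up.
  - exact: diffn_differentiable (diffn_derive u (smH 1)) Uy.
  - exact: diffn_differentiable (diffn_derive v (smH 1)) Uy.
have {e} /eqP := etrans (esym (DD u v)) (etrans e (DD v u)).
rewrite -subr_eq0 => /eqP <-.
rewrite /curv /DH ?(mx_trD, mx_trN) !trmx_mul.
mx_linear.
Qed.

(** The symmetry [conn_sym] holds on the whole open set U and can be differentiated. The
    differentiated form cancels the derivative terms, [conn_sym] itself the quadratic ones. *)
Lemma curv_bianchi y u v w : U y ->
  w *m curv y u v + u *m curv y v w + v *m curv y w u = 0.
Proof.
move=> Uy; have Dsym a b c : b *m 'D_a (fun z => conn C z c) y =
    c *m 'D_a (fun z => conn C z b) y.
  have [_ <-] := has_deriv_mulmxl b (dconn c a Uy).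
  have [_ <-] := has_deriv_mulmxl c (dconn b a Uy).
  by apply: derive_on oU Uy _ => z Uz; exact: conn_sym.
move: (Dsym u w v) (Dsym v w u) (Dsym w u v); rewrite /curv.
generalize_derive => e1 e2 e3; mx_expand; rewrite e1 e2 e3.
rewrite (conn_sym w v Uy) (conn_sym w u Uy) (conn_sym u v Uy).
mx_linear.
Qed.

Lemma curv_antisym y u v : curv y u v = - curv y v u.
Proof. rewrite /curv; mx_linear. Qed.

Lemma curv_pair y u v w z : (H y)^T = H y -> U y ->
  inner (H y) (w *m curv y u v) z = inner (H y) (u *m curv y w z) v.
Proof.
move=> symH Uy; apply: (@pair_symmetry _ _
  (fun a b c d => inner (H y) (c *m curv y a b) d)) => a b c d.
- by rewrite curv_antisym mulmxN innerNl.
- by rewrite curv_skew // inner_sym.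
- by rewrite -!innerDl curv_bianchi // inner0l.
Qed.

(** This is the integrability condition of a parallel phi: its derivative is the commutator of the
    connection form with phi, and equating the mixed second derivatives leaves the commutator of the
    curvature with phi. *)
Lemma curv_comm (phi : 'rV[R]_k -> 'M[R]_k) y u v :
  (forall d, diffn d U phi) -> (forall X Y, smooth_on U X -> smooth_on U Y ->
    forall y, U y ->
      nabla C X (fun z => Y z *m phi z) y = nabla C X Y y *m phi y) ->
  U y -> curv y u v *m phi y = phi y *m curv y u v.
Proof.
move=> sphi par Uy.
have Dphi z a : U z -> 'D_a phi z = conn C z a *m phi z - phi z *m conn C z a.
  move=> Uz; apply/row_matrixP => i; rewrite !rowE mulmxBr !mulmxA.
  have := par (cst a) (cst (delta_mx 0 i)) (smooth_cst _) (smooth_cst _) z Uz.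
  rewrite nabla_cst /nabla /= christE.
  have [_ ->] := has_deriv_mulmxl (delta_mx 0 i : 'rV_k)
    (diffn_has_deriv a (sphi 0) Uz).
  by move=> <-; rewrite addrK.
pose DP a z := conn C z a *m phi z - phi z *m conn C z a.
have DD a b : 'D_a ('D_b phi) y =
    'D_a (fun z => conn C z b) y *m phi y + conn C y b *m DP a y
    - (DP a y *m conn C y b + phi y *m 'D_a (fun z => conn C z b) y).
  have dc := dconn b a Uy.
  have dP : has_deriv phi y a (DP a y).
    by apply: has_deriv_eq (diffn_has_deriv a (sphi 0) Uy) _; exact: Dphi.
  apply: (etrans (derive_on a oU Uy (fun z => @Dphi z b))).
  by have [] := has_derivB (has_deriv_mulmx dc dP) (has_deriv_mulmx dP dc).
have e : 'D_u ('D_v phi) y = 'D_v ('D_u phi) y.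
  apply: (derive_comm_mx oU Uy).
  - by move=> p Up; exact: diffn_differentiable (sphi 0) Up.
  - exact: diffn_differentiable (diffn_derive u (sphi 1)) Uy.
  - exact: diffn_differentiable (diffn_derive v (sphi 1)) Uy.
have {e} /eqP := etrans (esym (DD u v)) (etrans e (DD v u)).
rewrite -subr_eq0 => /eqP e.
apply/eqP; rewrite -subr_eq0 -e /curv /DP; apply/eqP.
mx_linear.
Qed.

End levi_civita_connection.

(** * Existence of the Levi-Civita connection of a nondegenerate metric *)

Section levi_civita_existence.
Context {R : realType} {k : nat} (U : set 'rV[R]_k) (H : 'rV[R]_k -> 'M[R]_k).
Hypothesis oU : open U.
Hypothesis smH : forall d, diffn d U H.
Hypothesis symH : forall y, U y -> (H y)^T = H y.
Hypothesis unitH : forall y, U y -> H y \in unitmx.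

Let dH i y : 'M[R]_k := 'D_(delta_mx 0 i) H y.

(** Christoffel symbols of the first kind; [koszul] raises their last index. *)
Let lowered y i j : 'rV[R]_k :=
  \row_l (2^-1 * (dH i y j l + dH j y i l + (-1) * dH l y i j)).

Let koszul y i j : 'rV[R]_k := lowered y i j *m invmx (H y).

Lemma inner_sum (A : 'M[R]_k) u v :
  inner A u v = \sum_i \sum_j u 0 i * v 0 j * A i j.
Proof.
rewrite /inner mxE exchange_big; apply: eq_bigr => j _; rewrite !mxE mulr_suml.
by apply: eq_bigr => i _; ring.
Qed.

Let inner_derive y u v w : U y -> inner ('D_u H y) v w =
  \sum_i \sum_j \sum_l u 0 i * v 0 j * w 0 l * dH i y j l.
Proof.
move=> Uy; rewrite (derive_rV u (diffn_differentiable (smH 0) Uy)).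
rewrite inner_sum -/(dH _ _).
transitivity (\sum_j \sum_l \sum_i u 0 i * v 0 j * w 0 l * dH i y j l).
  apply: eq_bigr => j _; apply: eq_bigr => l _; rewrite summxE mulr_sumr.
  by apply: eq_bigr => i _; rewrite mxE /dH; ring.
rewrite [RHS]exchange_big; apply: eq_bigr => j _.
by rewrite exchange_big.
Qed.

Lemma koszulE y u v w : U y -> inner (H y) (christ koszul y u v) w =
  2^-1 * (inner ('D_u H y) v w + inner ('D_v H y) u w - inner ('D_w H y) u v).
Proof.
move=> Uy.
have lE i j : inner (H y) (koszul y i j) w =
    \sum_l w 0 l * (2^-1 * (dH i y j l + dH j y i l + (-1) * dH l y i j)).
  rewrite /inner /koszul mulmxKV ?unitH // mxE.
  by apply: eq_bigr => l _; rewrite !mxE mulrC.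
have -> : inner (H y) (christ koszul y u v) w =
    \sum_i \sum_j u 0 i * v 0 j * inner (H y) (koszul y i j) w.
  rewrite /christ /inner !mulmx_suml summxE; apply: eq_bigr => i _.
  rewrite !mulmx_suml summxE; apply: eq_bigr => j _.
  by rewrite -!scalemxAl mxE.
have := inner_derive w u v Uy; have := inner_derive v u w Uy.
have := inner_derive u v w Uy; generalize_inner => -> -> ->.
(* All sums are brought to the order i, j, l, in which the identity holds term by term. *)
have -> : \sum_j \sum_i \sum_l v 0 j * u 0 i * w 0 l * dH j y i l =
    \sum_i \sum_j \sum_l v 0 j * u 0 i * w 0 l * dH j y i l.
  by rewrite exchange_big.
have -> : \sum_l \sum_i \sum_j w 0 l * u 0 i * v 0 j * dH l y i j =
    \sum_i \sum_j \sum_l w 0 l * u 0 i * v 0 j * dH l y i j.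
  by rewrite exchange_big; apply: eq_bigr => i _; rewrite exchange_big.
rewrite -sumrN -!big_split mulr_sumr; apply: eq_bigr => i _ /=.
rewrite -sumrN -!big_split mulr_sumr; apply: eq_bigr => j _ /=.
rewrite lE -sumrN -!big_split !mulr_sumr; apply: eq_bigr => l _ /=.
ring.
Qed.

Let dH_sym y u : U y -> ('D_u H y)^T = 'D_u H y.
Proof.
move=> Uy; have [_ <-] := has_deriv_trmx (diffn_has_deriv u (smH 0) Uy).
exact: (derive_on u oU Uy symH).
Qed.

(** Torsion-freeness is the symmetry of the coefficients in i and j. For compatibility, two Koszul
    formulas with the last two arguments exchanged add up to the derivative of H along X. *)
Lemma exists_levi_civita : exists C, levi_civita U (fun y => inner (H y)) C.
Proof.
exists koszul; split=> [i j|X Y sX sY y Uy|X Y Z sX sY sZ y Uy].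
- apply: diffn_smooth_on => d.
  apply: diffn_mulmx => //; last exact: diffn_invmx.
  have ddH a b c : diffn d U (fun y => dH a y b c).
    have /(diffn_mxP _ _ oU) := diffn_derive (delta_mx 0 a) (smH d.+1).
    exact.
  apply/(diffn_mxP _ _ oU) => a b; under eq_fun do rewrite mxE.
  apply: diffnM => //; first exact: diffn_cst.
  by do ![apply: diffnD => //]; apply: diffnM => //; exact: diffn_cst.
- rewrite /nabla /lie_bracket.
  suff -> : christ koszul y (X y) (Y y) = christ koszul y (Y y) (X y).
    by rewrite opprD addrACA subrr addr0.
  rewrite /christ exchange_big; apply: eq_bigr => i _; apply: eq_bigr => j _.
  rewrite mulrC; congr (_ *: (_ *m _)); apply/rowP => l; rewrite !mxE.
  congr (2^-1 * (_ + -1 * _)); first exact: addrC.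
  have := dH_sym (delta_mx 0 l) Uy; rewrite -/(dH l y) => e.
  by rewrite -[in LHS]e mxE.
have dY := diffn_has_deriv (X y) (smooth_on_diffn 0 oU sY) Uy.
have dZ := diffn_has_deriv (X y) (smooth_on_diffn 0 oU sZ) Uy.
have [_ ->] := has_deriv_inner (diffn_has_deriv (X y) (smH 0) Uy) dY dZ.
rewrite /nabla innerDl innerDr.
have e : inner (H y) (Y y) (christ koszul y (X y) (Z y)) =
    inner (H y) (christ koszul y (X y) (Z y)) (Y y) by rewrite inner_sym ?symH.
have := inner_sym (Z y) (Y y) (dH_sym (X y) Uy).
have := koszulE (X y) (Y y) (Z y) Uy; have := koszulE (X y) (Z y) (Y y) Uy.
move: e; generalize_inner => *; lra.
Qed.

End levi_civita_existence.

(** * The phi-Sasaki metric *)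

Section metric_along.
Context {R : realType} {k : nat} (U : set 'rV[R]_k).
Variables (H : 'rV[R]_k -> 'M[R]_k) (C : 'rV[R]_k -> 'I_k -> 'I_k -> 'rV[R]_k).
Hypothesis oU : open U.
Hypothesis smH : forall d, diffn d U H.
Hypothesis lc : levi_civita U (fun y => inner (H y)) C.
Context {E : normedModType R}.
Variables (x u v : E -> 'rV[R]_k) (t d : E) (dx du dv : 'rV[R]_k).
Hypothesis Ux : U (x t).
Hypotheses (xt : has_deriv x t d dx) (ut : has_deriv u t d du).
Hypothesis vt : has_deriv v t d dv.

(** The parameter space E is arbitrary, so that curves, variations of curves and parametrizations
    are all covered. *)
Lemma has_deriv_metric :
  has_deriv (fun s => inner (H (x s)) (u s) (v s)) t d
    (inner (H (x t)) (du + u t *m conn C (x t) dx) (v t)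
     + inner (H (x t)) (u t) (dv + v t *m conn C (x t) dx)).
Proof.
have Ht := has_deriv_comp (diffn_differentiable (smH 0) Ux) xt.
apply: has_deriv_eq (has_deriv_inner Ht ut vt) _.
rewrite (derive_gram oU smH lc _ Ux) inner_addm inner_mull inner_mulr.
by rewrite innerDl innerDr; ring.
Qed.

Variable phi : 'rV[R]_k -> 'M[R]_k.
Hypothesis smphi : forall d, diffn d U phi.
Hypothesis par : forall X Y, smooth_on U X -> smooth_on U Y -> forall y, U y ->
  nabla C X (fun z => Y z *m phi z) y = nabla C X Y y *m phi y.

(** The plain derivative is given as (nabla v) phi minus the Christoffel term of v phi; that term
    cancels against the one added in [has_deriv_metric]. *)
Lemma has_deriv_parallel :
  has_deriv (fun s => v s *m phi (x s)) t d
    ((dv + v t *m conn C (x t) dx) *m phi (x t)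
     - v t *m phi (x t) *m conn C (x t) dx).
Proof.
have phit := has_deriv_comp (diffn_differentiable (smphi 0) Ux) xt.
apply: has_deriv_eq (has_deriv_mulmx vt phit) _.
have [sx sv] : smooth_on U (cst dx) /\ smooth_on U (cst (v t)).
  by split; apply: diffn_smooth_on => l; exact: diffn_cst.
have := par sx sv Ux; rewrite /nabla /= derive_cst add0r !christE.
have [_ ->] := has_deriv_mulmxl (v t) (diffn_has_deriv dx (smphi 0) Ux).
by rewrite mulmxDl => <-; rewrite addrA addrK.
Qed.

End metric_along.

(** The structure read in a single chart with image U; the geometric argument is local and takes
    place there. *)
Record pkn_chart {R : realType} {n : nat} (U : set 'rV[R]_n)
    (g phi : 'rV[R]_n -> 'M[R]_n)
    (C : 'rV[R]_n -> 'I_n -> 'I_n -> 'rV[R]_n) : Prop := PknChart {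
  pc_open : open U;
  pc_gram_smooth : forall d, diffn d U g;
  pc_phi_smooth : forall d, diffn d U phi;
  pc_gram_sym : forall y, U y -> (g y)^T = g y;
  pc_gram_pos : forall y v, U y -> v != 0 -> 0 < inner (g y) v v;
  pc_levi_civita : levi_civita U (fun y => inner (g y)) C;
  pc_invol : forall y, U y -> phi y *m phi y = 1%:M;
  pc_pure : forall y u v, U y ->
    inner (g y) (u *m phi y) v = inner (g y) u (v *m phi y);
  pc_parallel : forall X Y, smooth_on U X -> smooth_on U Y -> forall y, U y ->
    nabla C X (fun z => Y z *m phi z) y = nabla C X Y y *m phi y }.

Section sasaki_metric.
Context {R : realType} {n : nat} (U : set 'rV[R]_n).
Variables (g phi : 'rV[R]_n -> 'M[R]_n).
Variable C : 'rV[R]_n -> 'I_n -> 'I_n -> 'rV[R]_n.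
Hypothesis pk : pkn_chart U g phi C.
Implicit Types p w dp dw : 'rV[R]_(n + n).

Let oU := pc_open pk.
Let smg := pc_gram_smooth pk.
Let smphi := pc_phi_smooth pk.
Let symg := pc_gram_sym pk.
Let lc := pc_levi_civita pk.
Let pure := pc_pure pk.
Let par := pc_parallel pk.
Let smC := lc_smooth lc.
Local Notation G := (sasaki C g phi).
Local Notation pos p := (lsubmx p).
Local Notation vec p := (rsubmx p).

Lemma vpartE p w : vpart C p w = vec w + vec p *m conn C (pos p) (pos w).
Proof. by rewrite /vpart christE. Qed.

Lemma vpartP p : linear (vpart C p).
Proof.
move=> a w w'; rewrite !vpartE !linearP /= connP mulmxDr -scalemxAr scalerDr.
by rewrite addrACA.
Qed.

Lemma hpart_lift p X Y : hpart (hlift C p X + vlift Y) = X.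
Proof. by rewrite /hpart /hlift /vlift add_row_mx addr0 row_mxKl. Qed.

Lemma vpart_lift p X Y : vpart C p (hlift C p X + vlift Y) = Y.
Proof.
rewrite /vpart /hlift /vlift add_row_mx addr0 row_mxKl row_mxKr.
by rewrite addrAC addNr add0r.
Qed.

Lemma sasaki_scalarl p w' : scalar (G p ^~ w').
Proof.
move=> a w w2; rewrite /sasaki /hpart vpartP linearP /=.
rewrite (innerDl _ (_ *: pos w)) (innerDl _ (_ *: vpart _ _ _)) !innerZl.
by ring.
Qed.

Lemma sasaki_scalarr p w : scalar (G p w).
Proof.
move=> a w' w2; rewrite /sasaki /hpart vpartP linearP /=.
rewrite mulmxDl -scalemxAl (innerDr _ _ (_ *: pos w')).
by rewrite (innerDr _ _ (_ *: (vpart _ _ _ *m _))) !innerZr; ring.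
Qed.

Lemma sasaki_sym p w w' : U (pos p) -> G p w w' = G p w' w.
Proof.
move=> Up; rewrite /sasaki inner_sym ?symg //; congr (_ + _).
by rewrite inner_sym ?symg // pure.
Qed.

(* If [p], [w] are functions of a parameter with derivatives [dp], [dw], then
   [hcov] and [vcov] are the covariant derivatives of the horizontal and of the
   vertical part of [w] along the projection of [p]. *)
Definition hcov p dp w dw := pos dw + pos w *m conn C (pos p) (pos dp).

Definition vcov p dp w dw :=
  vec dw + vec dp *m conn C (pos p) (pos w)
  + vec p *m ('D_(pos dp) (fun y => conn C y (pos w)) (pos p)
              + conn C (pos p) (pos dw))
  + vpart C p w *m conn C (pos p) (pos dp).

Section along.
Context {E : normedModType R}.
Variables (p w : E -> 'rV[R]_(n + n)) (t d : E) (dp dw : 'rV[R]_(n + n)).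
Hypothesis Up : U (pos (p t)).
Hypotheses (pt : has_deriv p t d dp) (wt : has_deriv w t d dw).

Lemma has_deriv_vpart : has_deriv (fun s => vpart C (p s) (w s)) t d
  (vcov (p t) dp (w t) dw - vpart C (p t) (w t) *m conn C (pos (p t)) (pos dp)).
Proof.
under eq_fun do rewrite vpartE.
apply: has_deriv_eq.
  apply: has_derivD; first exact: has_deriv_rsubmx wt.
  apply: has_deriv_mulmx; first exact: has_deriv_rsubmx pt.
  exact: (@has_deriv_conn _ _ C U E (fun s => pos (p s)) (fun s => pos (w s))
    t d (pos dp) (pos dw) oU smC Up (has_deriv_lsubmx pt)
    (has_deriv_lsubmx wt)).
by rewrite /vcov addrK addrA.
Qed.

End along.

(** The product rule of the phi-Sasaki metric for [hcov] and [vcov]. The horizontal terms use that g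
    is parallel, the vertical ones that g and phi both are. *)
Lemma has_deriv_sasaki (E : normedModType R) (p w w' : E -> 'rV[R]_(n + n))
    (t d : E) (dp dw dw' : 'rV[R]_(n + n)) :
  U (pos (p t)) -> has_deriv p t d dp -> has_deriv w t d dw ->
  has_deriv w' t d dw' ->
  has_deriv (fun s => G (p s) (w s) (w' s)) t d
    (inner (g (pos (p t))) (hcov (p t) dp (w t) dw) (pos (w' t))
     + inner (g (pos (p t))) (pos (w t)) (hcov (p t) dp (w' t) dw')
     + (inner (g (pos (p t))) (vcov (p t) dp (w t) dw)
          (vpart C (p t) (w' t) *m phi (pos (p t)))
        + inner (g (pos (p t))) (vpart C (p t) (w t))
          (vcov (p t) dp (w' t) dw' *m phi (pos (p t))))).
Proof.
move=> Up pt wt wt'; have xt := has_deriv_lsubmx pt.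
have ht := has_deriv_lsubmx wt; have ht' := has_deriv_lsubmx wt'.
have vt := has_deriv_vpart Up pt wt; have vt' := has_deriv_vpart Up pt wt'.
pose x s := pos (p s); apply: has_derivD.
  exact: (@has_deriv_metric _ _ _ _ _ oU smg lc _ x _ _ _ _ _ _ _ Up xt ht ht').
have phit := @has_deriv_parallel _ _ _ _ oU _ x _ _ _ _ _ Up xt vt' _ smphi par.
apply: has_deriv_eq
  (@has_deriv_metric _ _ _ _ _ oU smg lc _ x _ _ _ _ _ _ _ Up xt vt phit) _.
by rewrite !subrK.
Qed.

(* The right-hand side is the metric product of E with the covariant
   acceleration, for the phi-Sasaki metric, of a curve through p with velocity w
   and with second coordinate derivative dw. *)
Lemma sasaki_first_variation p w dw E dE : U (pos p) ->
  inner (g (pos p)) (hcov p w w dw) (pos E)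
  + inner (g (pos p)) (pos w) (hcov p w E dE)
  + (inner (g (pos p)) (vcov p w w dw) (vpart C p E *m phi (pos p))
     + inner (g (pos p)) (vpart C p w) (vcov p w E dE *m phi (pos p)))
  - (inner (g (pos p)) (hcov p E w dE) (pos w)
     + inner (g (pos p)) (vcov p E w dE) (vpart C p w *m phi (pos p))) =
  G p (hlift C p (hcov p w w dw
         - curvature C (pos p) (vpart C p w) (vec p *m phi (pos p)) (pos w))
       + vlift (vcov p w w dw)) E.
Proof.
move=> Up; set x := pos p in Up *.
have hE : hcov p w E dE = hcov p E w dE.
  by rewrite /hcov (conn_sym oU lc _ _ Up).
(* Horizontally the two directions commute because the base connection is torsion-free; vertically
   they do not, and this is the only source of the curvature term. *)
have vE : vcov p w E dE =
    vcov p E w dE + vec p *m curv C x (pos w) (pos E).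
  by rewrite /vcov /curv !vpartE -/x; mx_linear.
rewrite {1}/sasaki hpart_lift vpart_lift {1}/hpart -/x.
rewrite hE vE (curvatureE oU lc) //.
set h := hcov p w w dw; set h' := hcov p E w dE.
set v := vcov p w w dw; set v' := vcov p E w dE; set z := vpart C p w.
rewrite innerBl (mulmxDl v') (innerDr _ z) -/x.
have -> : inner (g x) h' (pos w) = inner (g x) (pos w) h'.
  by rewrite inner_sym ?symg.
have -> : inner (g x) v' (z *m phi x) = inner (g x) z (v' *m phi x).
  by rewrite -pure // inner_sym ?symg.
(* Commutation with phi moves phi next to xi, and pair symmetry exchanges the directions (w, E) with
   the pair (z, phi xi). *)
have -> : inner (g x) (pos w *m curv C x z (vec p *m phi x)) (pos E) =
    - inner (g x) z (vec p *m curv C x (pos w) (pos E) *m phi x).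
  rewrite -mulmxA (curv_comm oU lc _ _ smphi par Up) mulmxA.
  rewrite [in RHS]inner_sym ?symg // [in RHS](curv_pair oU smg lc) ?symg //.
  by rewrite [in RHS]curv_antisym mulmxN innerNl opprK.
by ring.
Qed.

End sasaki_metric.

(** * The unit bundle and its induced metric *)

(** A dimension count: the rows of J span n.-1 dimensions inside the kernel of f, which is no larger
    because f does not vanish at e. *)
Lemma scalar_ker_row_free (R : realType) (n : nat) (J : 'M[R]_(n.-1, n))
    (f : 'rV[R]_n -> R) (e : 'rV[R]_n) : scalar f -> f e != 0 ->
  row_free J -> (forall a, f (a *m J) = 0) ->
  forall w, f w = 0 -> exists a, w = a *m J.
Proof.
move=> fl fe freeJ fJ w fw.
pose N : 'cV[R]_n := \col_i f (delta_mx 0 i).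
have NE z : z *m N = (f z)%:M.
  apply/rowP => j; rewrite ord1 !mxE eqxx mulr1n (scalar_rV z fl).
  by apply: eq_bigr => i _; rewrite mxE.
have JN : (J <= kermx N)%MS.
  apply/sub_kermxP/row_matrixP => i; rewrite row_mul NE rowE fJ row0.
  by apply/rowP => j; rewrite !mxE mul0rn.
have rN : (0 < \rank N)%N.
  rewrite lt0n mxrank_eq0; apply/eqP => N0; move: (NE e); rewrite N0 mulmx0.
  move=> /rowP/(_ 0); rewrite !mxE eqxx mulr1n => /esym/eqP.
  by rewrite (negPf fe).
have wk : (w <= kermx N)%MS.
  by apply/sub_kermxP; rewrite NE fw; apply/rowP => j; rewrite !mxE mul0rn.
apply/submxP; apply: (submx_trans wk).
rewrite -(mxrank_leqif_sup JN).2 (eqP freeJ) mxrank_ker eqn_leq.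
apply/andP; split; last by rewrite -subn1 leq_sub2l.
by have := mxrankS JN; rewrite (eqP freeJ) mxrank_ker.
Qed.

Section unit_bundle.
Context {R : realType} {n : nat} (U : set 'rV[R]_n).
Variables (g phi : 'rV[R]_n -> 'M[R]_n).
Variable C : 'rV[R]_n -> 'I_n -> 'I_n -> 'rV[R]_n.
Hypothesis pk : pkn_chart U g phi C.
Implicit Types p w dp dw : 'rV[R]_(n + n).

Let oU := pc_open pk.
Let smg := pc_gram_smooth pk.
Let smphi := pc_phi_smooth pk.
Let symg := pc_gram_sym pk.
Let lc := pc_levi_civita pk.
Let par := pc_parallel pk.

Local Notation G := (sasaki C g phi).
Local Notation S := (unit_bundle g phi U).
Local Notation pos p := (lsubmx p).
Local Notation vec p := (rsubmx p).

(* The product of w with the unit normal [vlift (vec p)] of the unit bundle. *)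
Definition normal_part p w :=
  inner (g (pos p)) (vpart C p w) (vec p *m phi (pos p)).

Lemma normal_partE p w : G p w (vlift (vec p)) = normal_part p w.
Proof. by rewrite /sasaki hpart_vlift vpart_vlift inner0r add0r. Qed.

Lemma normal_part_scalar p : scalar (normal_part p).
Proof.
move=> a w w'; rewrite -!normal_partE.
by rewrite (@sasaki_scalarl _ _ g phi C p (vlift (vec p)) a w w').
Qed.

(** The level function g(xi, phi xi) has differential 2 G(., ^V xi), which is why ^V xi is normal to
    the unit bundle. The two equal terms come from the purity of phi. *)
Lemma has_deriv_unit_level (E : normedModType R) (p : E -> 'rV[R]_(n + n))
    t d dp :
  U (pos (p t)) -> has_deriv p t d dp ->
  has_deriv (fun s => inner (g (pos (p s))) (vec (p s))
    (vec (p s) *m phi (pos (p s)))) t d (2 * normal_part (p t) dp).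
Proof.
move=> Up pt; have xt := has_deriv_lsubmx pt; have vt := has_deriv_rsubmx pt.
pose x s := pos (p s).
have phit := @has_deriv_parallel _ _ _ _ oU _ x _ _ _ _ _ Up xt vt _ smphi par.
apply: has_deriv_eq
  (@has_deriv_metric _ _ _ _ _ oU smg lc _ x _ _ _ _ _ _ _ Up xt vt phit) _.
rewrite subrK -!vpartE /normal_part mulr2n mulrDl mul1r; congr (_ + _).
by rewrite -(pc_pure pk) // inner_sym ?symg.
Qed.

Lemma tangent_normal_part (k : nat) (W : set 'rV[R]_k)
    (psi : 'rV[R]_k -> 'rV[R]_(n + n)) (w u : 'rV[R]_k) : open W ->
  (forall w : 'rV[R]_k, W w -> S (psi w)) -> W w -> differentiable psi w ->
  normal_part (psi w) (u *m 'J psi w) = 0.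
Proof.
move=> oW psiS Ww dpsi; rewrite -deriveEjacobian //.
have [Up _] := psiS _ Ww.
have [_ e] := has_deriv_unit_level Up (has_derivP u dpsi).
have e0 := derive_on u oW Ww (fun z Wz => (psiS z Wz).2).
have [_ e1] : has_deriv (fun=> 1 : R) w u 0 by exact: has_deriv_cst.
have := etrans (esym e) (etrans e0 e1).
by move=> /eqP; rewrite mulf_eq0 pnatr_eq0 => /eqP.
Qed.

(** Since G is indefinite, w is paired not with itself but with its horizontal part plus phi of its
    vertical part; as phi is an involution, the product is g(h, h) + g(v, v). *)
Lemma sasaki_nondegenerate p w :
  U (pos p) -> (forall w', G p w w' = 0) -> w = 0.
Proof.
move=> Up Gw.
have := Gw (hlift C p (hpart w) + vlift (vpart C p w *m phi (pos p))).
rewrite /sasaki hpart_lift vpart_lift.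
rewrite -mulmxA (pc_invol pk) // mulmx1.
have gge0 u : 0 <= inner (g (pos p)) u u.
  have [->|u0] := eqVneq u 0; first by rewrite inner0l.
  exact/ltW/(pc_gram_pos pk).
have g0 u : inner (g (pos p)) u u = 0 -> u = 0.
  move=> e; apply/eqP/negPn/negP => u0.
  by have := pc_gram_pos pk Up u0; rewrite e ltxx.
move=> /eqP; rewrite paddr_eq0 // => /andP[/eqP/g0 h0 /eqP/g0 v0].
by rewrite (hv_decomposition C p w) h0 v0 /hlift /vlift row_mx0
  christE conn0 mulmx0 oppr0 row_mx0 addr0.
Qed.

(** An indefinite form may degenerate on a subspace. Here the normal ^V xi has square 1, so any w'
    splits into a normal and a tangent vector, and w is orthogonal to both. *)
Lemma tangent_nondegenerate p (J : 'M[R]_((n + n).-1, n + n)) w : S p ->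
  row_free J -> (forall a, normal_part p (a *m J) = 0) ->
  normal_part p w = 0 -> (forall a, G p w (a *m J) = 0) -> w = 0.
Proof.
move=> [Up levelp] freeJ nJ nw Gw; apply: (sasaki_nondegenerate Up) => w'.
have nN : normal_part p (vlift (vec p)) = 1.
  by rewrite /normal_part vpart_vlift.
pose w0 := - normal_part p w' *: vlift (vec p) + w'.
have [a aE] : exists a, w0 = a *m J.
  apply: (@scalar_ker_row_free _ _ J _ (vlift (vec p))
    (@normal_part_scalar p)) nJ _ _ => //.
    by rewrite nN oner_neq0.
  by rewrite normal_part_scalar nN; ring.
have -> : w' = normal_part p w' *: vlift (vec p) + w0.
  by rewrite /w0 scaleNr addrA addrN add0r.
by rewrite sasaki_scalarr normal_partE nw aE Gw mulr0 addr0.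
Qed.

End unit_bundle.

Section diffn_forms.
Context {R : realType}.

Lemma diffn_scalemx (E : normedModType R) m n k (U : set E) (a : E -> R)
    (f : E -> 'M[R]_(m, n)) : open U ->
  diffn k U a -> diffn k U f -> diffn k U (fun z => a z *: f z).
Proof.
move=> oU da /(diffn_mxP _ _ oU) df; apply/(diffn_mxP _ _ oU) => i j.
by under eq_fun do rewrite mxE; exact: diffnM.
Qed.

Lemma diffn_inner (E : normedModType R) n k (U : set E) (A : E -> 'M[R]_n)
    (u v : E -> 'rV[R]_n) : open U ->
  diffn k U A -> diffn k U u -> diffn k U v ->
  diffn k U (fun z => inner (A z) (u z) (v z)).
Proof.
move=> oU dA du dv.
have /(diffn_mxP _ _ oU)/(_ 0 0) := diffn_mulmx oU (diffn_mulmx oU du dA)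
  (diffn_trmx oU dv).
exact.
Qed.

Lemma diffn_jacobian k n d (W : set 'rV[R]_k) (psi : 'rV[R]_k -> 'rV[R]_n) :
  open W -> diffn d.+1 W psi -> diffn d W (fun w => 'J psi w).
Proof.
move=> oW dpsi; apply/(diffn_mxP _ _ oW) => i j.
apply: (@diffn_ext _ _ _ _ _ (fun w => 'D_(delta_mx 0 i) psi w 0 j)) => //.
  move=> w Ww; rewrite deriveEjacobian -?rowE ?mxE //.
  exact: diffn_differentiable dpsi Ww.
by have /(diffn_mxP _ _ oW) := diffn_derive (delta_mx 0 i) dpsi; exact.
Qed.

Lemma derive_jacobian_sym k n (W : set 'rV[R]_k) (psi : 'rV[R]_k -> 'rV[R]_n)
    w u v : open W -> W w -> diffn 1 W psi ->
  u *m 'D_v (fun z => 'J psi z) w = v *m 'D_u (fun z => 'J psi z) w.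
Proof.
move=> oW Ww dpsi.
have dJ a b : a *m 'D_b (fun z => 'J psi z) w = 'D_b ('D_a psi) w.
  have [_ <-] := has_deriv_mulmxl a
    (diffn_has_deriv b (diffn_jacobian oW dpsi) Ww).
  apply: derive_on oW Ww _ => z Wz; rewrite deriveEjacobian //.
  exact: diffn_differentiable dpsi Wz.
rewrite !dJ; apply: (derive_comm_mx oW Ww).
- by move=> z Wz; exact: diffn_differentiable dpsi Wz.
- exact: diffn_differentiable (diffn_derive v dpsi) Ww.
- exact: diffn_differentiable (diffn_derive u dpsi) Ww.
Qed.

End diffn_forms.

(** * The induced metric of a local parametrization and its connection *)

Section induced_metric.
Context {R : realType} {n : nat} (U : set 'rV[R]_n).
Variables (g phi : 'rV[R]_n -> 'M[R]_n).
Variable C : 'rV[R]_n -> 'I_n -> 'I_n -> 'rV[R]_n.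
Hypothesis pk : pkn_chart U g phi C.

Let oU := pc_open pk.
Let smg := pc_gram_smooth pk.
Let smphi := pc_phi_smooth pk.
Let lc := pc_levi_civita pk.
Let smC := lc_smooth lc.

Local Notation G := (sasaki C g phi).
Local Notation S := (unit_bundle g phi U).
Local Notation pos p := (lsubmx p).
Local Notation vec p := (rsubmx p).

Lemma diffn_sasaki (E : normedModType R) k (W : set E)
    (p w w' : E -> 'rV[R]_(n + n)) : open W ->
  (forall z, W z -> U (pos (p z))) ->
  diffn k W p -> diffn k W w -> diffn k W w' ->
  diffn k W (fun z => G (p z) (w z) (w' z)).
Proof.
move=> oW pU dp dw dw'; have dx := diffn_lsubmx oW dp.
have comp (f : 'rV[R]_n -> 'M[R]_n) : (forall d, diffn d U f) ->
    diffn k W (fun z => f (pos (p z))).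
  by move=> df; exact: (diffn_comp_mx oU oW pU (df k) dx).
have dv q : diffn k W q -> diffn k W (fun z => vpart C (p z) (q z)).
  move=> dq; under eq_fun do rewrite vpartE.
  apply: diffnD => //; first exact: diffn_rsubmx.
  apply: diffn_mulmx => //; first exact: diffn_rsubmx.
  under eq_fun do rewrite connE.
  apply: diffn_sum => // i _; apply: diffn_scalemx => //.
    by have /(diffn_mxP _ _ oW) := diffn_lsubmx oW dq; exact.
  by apply: (comp (fun y => conn C y (delta_mx 0 i))) => d; exact: diffn_conn.
apply: diffnD => //; apply: diffn_inner => //; try exact: comp.
- exact: diffn_lsubmx.
- exact: diffn_lsubmx.
- exact: dv.
- by apply: diffn_mulmx => //; [exact: dv|exact: comp].
Qed.

Section parametrization.
Variables (W : set 'rV[R]_((n + n).-1)).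
Variable psi : 'rV[R]_((n + n).-1) -> 'rV[R]_(n + n).
Hypothesis lp : local_param S W psi.

Let oW := lp_open lp.

Let smpsi d : diffn d W psi.
Proof. exact: smooth_on_diffn (lp_smooth lp). Qed.

Let dpsi w : W w -> differentiable psi w.
Proof. exact: diffn_differentiable (smpsi 0). Qed.

(** The inclusion in the unit bundle is extracted from the homeomorphism clause, taken at the open
    set W itself. *)
Lemma local_param_in w : W w -> S (psi w).
Proof.
move=> Ww; have [V _ e] := lp_homeo lp oW (@subset_refl _ W).
suff : (S `&` V) (psi w) by case.
by rewrite -e; exists w.
Qed.

Definition induced_gram w : 'M[R]_((n + n).-1) := \matrix_(i, j)
  induced_metric G psi w (delta_mx 0 i) (delta_mx 0 j).

Lemma induced_metricE :
  induced_metric G psi = fun w => inner (induced_gram w).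
Proof.
apply/funext => w; apply: inner_bilinear => v a u u'.
  by rewrite /induced_metric mulmxDl -scalemxAl sasaki_scalarl.
by rewrite /induced_metric mulmxDl -scalemxAl sasaki_scalarr.
Qed.

Lemma diffn_induced_gram d : diffn d W induced_gram.
Proof.
apply/(diffn_mxP _ _ oW) => i j; under eq_fun do rewrite mxE.
have dJ l : diffn d W (fun w => (delta_mx 0 l : 'rV_((n + n).-1)) *m 'J psi w).
  by apply: diffn_mulmx => //; [exact: diffn_cst|exact: diffn_jacobian].
by apply: diffn_sasaki => // w Ww; have [] := local_param_in Ww.
Qed.

Lemma induced_gram_sym w : W w -> (induced_gram w)^T = induced_gram w.
Proof.
move=> Ww; apply/matrixP => i j; rewrite !mxE /induced_metric.
by apply: (sasaki_sym pk); have [] := local_param_in Ww.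
Qed.

Lemma normal_part_jacobian w a : W w ->
  normal_part g phi C (psi w) (a *m 'J psi w) = 0.
Proof.
move=> Ww; apply: (tangent_normal_part pk a oW local_param_in Ww).
exact: dpsi.
Qed.

Lemma induced_gram_unit w : W w -> induced_gram w \in unitmx.
Proof.
move=> Ww; rewrite -row_free_unit; apply: inj_row_free => v vH.
have vJ : v *m 'J psi w = 0.
  apply: (tangent_nondegenerate pk (local_param_in Ww) (lp_immersion lp Ww)).
  - by move=> a; exact: normal_part_jacobian.
  - exact: normal_part_jacobian.
  move=> a; rewrite -[LHS]/(induced_metric G psi w v a) induced_metricE.
  by rewrite /inner vH mul0mx mxE.
by apply: (row_free_inj (lp_immersion lp Ww)); rewrite vJ mul0mx.
Qed.

Lemma exists_induced_connection :
  exists C', levi_civita W (induced_metric G psi) C'.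
Proof.
rewrite induced_metricE; apply: exists_levi_civita => //.
- exact: diffn_induced_gram.
- exact: induced_gram_sym.
- exact: induced_gram_unit.
Qed.

End parametrization.

End induced_metric.

Lemma has_deriv_unique (R : realType) (E V : normedModType R) (f g : E -> V)
    (U : set E) t d df dg : open U -> U t -> (forall s, U s -> f s = g s) ->
  has_deriv f t d df -> has_deriv g t d dg -> df = dg.
Proof. by move=> oU Ut fg [_ <-] [_ <-]; exact: derive_on oU Ut fg. Qed.

(** * The acceleration in the unit bundle, for any parametrization *)

Section induced_acceleration.
Context {R : realType} {n : nat} (U : set 'rV[R]_n).
Variables (g phi : 'rV[R]_n -> 'M[R]_n).
Variable C : 'rV[R]_n -> 'I_n -> 'I_n -> 'rV[R]_n.
Hypothesis pk : pkn_chart U g phi C.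

Let oU := pc_open pk.
Let smg := pc_gram_smooth pk.
Let smphi := pc_phi_smooth pk.
Let symg := pc_gram_sym pk.
Let lc := pc_levi_civita pk.
Let par := pc_parallel pk.

Local Notation G := (sasaki C g phi).
Local Notation S := (unit_bundle g phi U).
Local Notation pos p := (lsubmx p).
Local Notation vec p := (rsubmx p).
Local Notation N := (n + n).-1.

(* The covariant acceleration in the unit bundle of a curve through p with
   velocity w and second coordinate derivative dw. *)
Definition unit_acceleration p w dw : 'rV[R]_(n + n) :=
  hlift C p (hcov C p w w dw
    - curvature C (pos p) (vpart C p w) (vec p *m phi (pos p)) (pos w))
  + vlift (vcov C p w w dw
    + inner (g (pos p)) (vpart C p w) (vpart C p w *m phi (pos p)) *: vec p).

Variables (W : set 'rV[R]_N) (psi : 'rV[R]_N -> 'rV[R]_(n + n)).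
Variable C' : 'rV[R]_N -> 'I_N -> 'I_N -> 'rV[R]_N.
Hypothesis lp : local_param S W psi.
Hypothesis lc' : levi_civita W (induced_metric G psi) C'.
Variables (J : set R) (c : R -> 'rV[R]_N) (t : R).
Hypotheses (oJ : open J) (Jt : J t) (smc : smooth_curve J c).
Hypothesis Wc : forall s, J s -> W (c s).

Let oW := lp_open lp.
Let smpsi d : diffn d W psi.
Proof. exact: smooth_on_diffn (lp_smooth lp). Qed.
Let dJ w v : W w ->
  has_deriv (fun z => 'J psi z) w v ('D_v (fun z => 'J psi z) w).
Proof. exact: (diffn_has_deriv v (diffn_jacobian oW (smpsi 1))). Qed.
Let H := induced_gram g phi C psi.
Let smH : forall d, diffn d W H := diffn_induced_gram pk lp.
Let lcH : levi_civita W (fun w => inner (H w)) C'.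
Proof. by move: lc'; rewrite induced_metricE. Qed.
Let Gam s := psi (c s).
Let dc := derive1 c.
Let dGam s := dc s *m 'J psi (c s).
Let ddc := derive1 dc t.
Let ddGam := ddc *m 'J psi (c t) + dc t *m 'D_(dc t) (fun z => 'J psi z) (c t).

Let dcE s : J s -> has_deriv c s 1 (dc s).
Proof. exact: smooth_curve_has_deriv. Qed.

Let ddcE : has_deriv dc t 1 ddc.
Proof. exact: smooth_curve_has_deriv (smooth_curve_derive1 smc) Jt. Qed.

Lemma has_deriv_lift s : J s -> has_deriv Gam s 1 (dGam s).
Proof.
move=> Js; rewrite /dGam -deriveEjacobian; last first.
  exact: diffn_differentiable (smpsi 0) (Wc Js).
apply: has_deriv_comp (dcE Js).
exact: diffn_differentiable (smpsi 0) (Wc Js).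
Qed.

Let Wt := Wc Jt.

Let dJc : has_deriv (fun s => 'J psi (c s)) t 1
  ('D_(dc t) (fun z => 'J psi z) (c t)).
Proof. exact: (has_deriv_comp (dJ 0 Wt).1 (dcE Jt)). Qed.

Lemma has_deriv_lift2 : has_deriv dGam t 1 ddGam.
Proof. exact: (has_deriv_mulmx ddcE dJc). Qed.

Let Gt : U (pos (Gam t)).
Proof. by have [] := local_param_in lp Wt. Qed.

Let has_deriv_tangent (u : 'rV[R]_N) :
  has_deriv (fun s => u *m 'J psi (c s)) t 1
  (u *m 'D_(dc t) (fun z => 'J psi z) (c t)).
Proof. exact: (has_deriv_mulmxl u dJc). Qed.

(* The Euler-Lagrange form [h (acc, u) = d/dt h (c', u) - (D_u h) (c', c') / 2]
   of the acceleration in the parameter domain, compared with the same expression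
   for G along [psi \o c]. *)
Lemma induced_acceleration_form u :
  inner (H (c t)) (acceleration C' c t) u =
  G (Gam t) (hlift C (Gam t) (hcov C (Gam t) (dGam t) (dGam t) ddGam
       - curvature C (pos (Gam t)) (vpart C (Gam t) (dGam t))
           (vec (Gam t) *m phi (pos (Gam t))) (pos (dGam t)))
     + vlift (vcov C (Gam t) (dGam t) (dGam t) ddGam)) (u *m 'J psi (c t)).
Proof.
have line : has_deriv (fun s : R => c t + s *: u) 0 1 u.
  exact: has_deriv_line.
have c0 : c t + 0 *: u = c t by rewrite scale0r addr0.
have W0 : W (c t + 0 *: u) by rewrite c0.
(* [e1] is the time derivative of h(c', u) and [e2] the derivative of h(c', c') in the direction u
   with c' frozen, both through [C']. [e1'] and [e2'] are the same numbers through [hcov] and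
   [vcov]. *)
have e1 := @has_deriv_metric _ _ _ _ _ oW smH lcH _ c dc (cst u) t 1 _ _ 0 Wt
  (dcE Jt) ddcE (has_deriv_cst _ _ _).
have e2 := @has_deriv_metric _ _ _ _ _ oW smH lcH _ (fun s : R => c t + s *: u)
  (cst (dc t)) (cst (dc t)) 0 1 _ 0 0 W0 line (has_deriv_cst _ _ _)
  (has_deriv_cst _ _ _).
have e1' := has_deriv_sasaki pk Gt (has_deriv_lift Jt) has_deriv_lift2
  (has_deriv_tangent u).
have psil : has_deriv (fun s : R => psi (c t + s *: u)) 0 1 (u *m 'J psi (c t)).
  rewrite -deriveEjacobian; last exact: diffn_differentiable (smpsi 0) Wt.
  exact/has_deriv_comp_line/(diffn_differentiable (smpsi 0) Wt).
(* By symmetry of the second derivative of psi, varying the velocity along u gives the same vector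
   as moving the lift of u along the curve. *)
have Yl : has_deriv (fun s : R => dc t *m 'J psi (c t + s *: u)) 0 1
    (u *m 'D_(dc t) (fun z => 'J psi z) (c t)).
  rewrite (derive_jacobian_sym _ _ oW Wt (smpsi 1)).
  exact: (has_deriv_mulmxl (dc t) (has_deriv_comp_line u (dJ 0 Wt).1)).
have U0 : U (pos (psi (c t + 0 *: u))) by rewrite c0.
have e2' := has_deriv_sasaki pk U0 psil Yl Yl.
have HG w a b : inner (H w) a b = G (psi w) (a *m 'J psi w) (b *m 'J psi w).
  by rewrite -[RHS]/(induced_metric G psi w a b) induced_metricE.
have k1 := has_deriv_unique oJ Jt (fun (s : R) _ => HG (c s) (dc s) u) e1 e1'.
have k2 := has_deriv_unique openT I
  (fun (s : R) _ => HG (c t + s *: u) (dc t) (dc t)) e2 e2'.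
have := sasaki_first_variation pk (dGam t) ddGam (u *m 'J psi (c t))
  (u *m 'D_(dc t) (fun z => 'J psi z) (c t)) Gt.
move: k1 k2; rewrite /= !c0 !add0r -/(Gam t) -/(dGam t).
rewrite (conn_sym oW lcH u (dc t) Wt).
rewrite /acceleration /cov_along -/dc -/ddc christE.
rewrite (inner_sym (dc t) (dc t *m _) (induced_gram_sym pk lp Wt)).
set E := u *m 'J psi (c t); set dE := u *m 'D_(dc t) _ _.
rewrite (inner_sym (pos (dGam t)) (hcov C (Gam t) E (dGam t) dE) (symg Gt)).
rewrite -(pc_pure pk (vpart C (Gam t) (dGam t))
  (vcov C (Gam t) E (dGam t) dE) Gt).
rewrite (inner_sym (vpart C (Gam t) (dGam t) *m _)
  (vcov C (Gam t) E (dGam t) dE) (symg Gt)).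
(* [r0] is the mixed term h(c', nabla_u c'), present in both identities; the first minus half of the
   second eliminates it. *)
have solve (r r0 r1 r2 r3 r4 r6 r8 z : R) : r + r0 = r1 + r2 + (r3 + r4) ->
    r0 + r0 = r6 + r6 + (r8 + r8) ->
    r1 + r2 + (r3 + r4) - (r6 + r8) = z -> r = z by move=> *; lra.
exact: solve.
Qed.

Lemma normal_part_acceleration :
  normal_part g phi C (Gam t) (unit_acceleration (Gam t) (dGam t) ddGam) = 0.
Proof.
rewrite /normal_part /unit_acceleration vpart_lift innerDl innerZl.
have [_ ->] := local_param_in lp Wt; rewrite mulr1.
have vt := has_deriv_vpart pk Gt (has_deriv_lift Jt) has_deriv_lift2.
have xt := has_deriv_lsubmx (has_deriv_lift Jt).
pose x s := pos (Gam s).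
have phit := @has_deriv_parallel _ _ _ _ oU _ x _ _ _ _ _ Gt xt
  (has_deriv_rsubmx (has_deriv_lift Jt)) _ smphi par.
have e1 := @has_deriv_metric _ _ _ _ _ oU smg lc _ x _ _ _ _ _ _ _ Gt xt vt
  phit.
have e0 : has_deriv (fun=> 0 : R) t 1 0 by exact: has_deriv_cst.
have n0 s : J s -> normal_part g phi C (Gam s) (dGam s) = 0.
  by move=> Js; exact: (normal_part_jacobian pk lp _ (Wc Js)).
have := has_deriv_unique oJ Jt n0 e1 e0.
by rewrite !subrK -vpartE.
Qed.

(** Both sides are tangent and have equal products with every tangent vector, since the multiple of
    ^V xi that distinguishes the right side from the ambient acceleration is normal. Nondegeneracy
    on the tangent space concludes. *)
Lemma induced_acceleration_eq : acceleration C' c t *m 'J psi (c t) =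
  unit_acceleration (Gam t) (dGam t) ddGam.
Proof.
(* The difference is put in the shape -1 *: _ + _, the one in which [scalar] is stated. *)
apply/eqP; rewrite -subr_eq0 -opprB oppr_eq0 addrC -scaleN1r; apply/eqP.
apply: (tangent_nondegenerate pk (local_param_in lp Wt) (lp_immersion lp Wt)).
- by move=> a; exact: (normal_part_jacobian pk lp a Wt).
- by rewrite normal_part_scalar normal_part_acceleration
    (normal_part_jacobian pk lp _ Wt) mulr0 addr0.
move=> a; rewrite sasaki_scalarl.
have -> : G (psi (c t)) (acceleration C' c t *m 'J psi (c t))
    (a *m 'J psi (c t)) = inner (H (c t)) (acceleration C' c t) a.
  by rewrite -[LHS]/(induced_metric G psi (c t) _ a) induced_metricE.
rewrite induced_acceleration_form -/(Gam t).
have -> : unit_acceleration (Gam t) (dGam t) ddGam =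
    inner (g (pos (Gam t))) (vpart C (Gam t) (dGam t))
      (vpart C (Gam t) (dGam t) *m phi (pos (Gam t))) *: vlift (vec (Gam t)) +
    (hlift C (Gam t) (hcov C (Gam t) (dGam t) (dGam t) ddGam
       - curvature C (pos (Gam t)) (vpart C (Gam t) (dGam t))
           (vec (Gam t) *m phi (pos (Gam t))) (pos (dGam t)))
     + vlift (vcov C (Gam t) (dGam t) (dGam t) ddGam)).
  rewrite /unit_acceleration [RHS]addrCA; congr (_ + _).
  by rewrite /vlift scale_row_mx add_row_mx scaler0 add0r addrC.
rewrite sasaki_scalarl (sasaki_sym pk (vlift _) _ Gt) normal_partE.
by rewrite (normal_part_jacobian pk lp a Wt) mulr0 add0r mulN1r addNr.
Qed.

End induced_acceleration.

(** * A local parametrization of the unit bundle *)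

Section open_preimage.
Context {R : realType}.
Implicit Types E V : normedModType R.

Lemma open_preimage E (V : topologicalType) (U : set E) (O : set V)
    (f : E -> V) :
  open U -> open O -> (forall z, U z -> {for z, continuous f}) ->
  open (U `&` f @^-1` O).
Proof.
move=> oU oO cf; rewrite openE => z [Uz Oz]; apply: filterI.
  exact: open_nbhs_nbhs.
by apply: (cf _ Uz); exact: open_nbhs_nbhs.
Qed.

Lemma open_positive E (U : set E) (f : E -> R) : open U -> diffn 0 U f ->
  open [set z | U z /\ 0 < f z].
Proof.
move=> oU [df _]; have oP : open [set x : R | 0 < x] by exact: open_gt.
apply: (open_preimage oU oP) => z Uz.
exact/differentiable_continuous/df.
Qed.

Lemma diffn_id E k (U : set E) : open U -> diffn k U id.
Proof.
by move=> oU; apply: (@diffn_linear _ E E k U idfun) => // x; exact: cvg_id.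
Qed.

End open_preimage.

(* The graph-like parametrization
   [(u, y) |-> (y, omega u / sqrt (h_y (omega u, omega u)))] of the hypersurface
   [h_y (v, v) = 1], where [h_y (v, w)] is [inner (g y) v (w *m phi y)] and
   [omega u] is [u] with the nonzero entry [a] inserted at [i]. *)
Section radial_parametrization.
Context {R : realType} {n : nat} (U : set 'rV[R]_n.+1).
Variables (g phi : 'rV[R]_n.+1 -> 'M[R]_n.+1).
Hypotheses (oU : open U) (smg : forall d, diffn d U g).
Hypothesis smphi : forall d, diffn d U phi.
Variables (i : 'I_n.+1) (a : R).
Hypothesis a0 : a != 0.

Local Notation S := (unit_bundle g phi U).
Local Notation pos p := (lsubmx p).
Local Notation vec p := (rsubmx p).

Definition insert_entry (u : 'rV[R]_n) : 'rV[R]_n.+1 :=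
  \row_j oapp (fun k => u 0 k) a (unlift i j).

Definition radial_form (w : 'rV[R]_(n + n.+1)) : R :=
  inner (g (rsubmx w)) (insert_entry (lsubmx w))
    (insert_entry (lsubmx w) *m phi (rsubmx w)).

Definition radial_dom : set 'rV[R]_(n + n.+1) :=
  [set w | U (rsubmx w) /\ 0 < radial_form w].

Definition radial_param (w : 'rV[R]_(n + n.+1)) : 'rV[R]_(n.+1 + n.+1) :=
  row_mx (rsubmx w) ((Num.sqrt (radial_form w))^-1 *: insert_entry (lsubmx w)).

(** Where the entry i has the sign of [a], the quotient by [a] is the factor introduced by
    normalizing, so dividing by it recovers the unnormalized vector. *)
Definition radial_codom : set 'rV[R]_(n.+1 + n.+1) :=
  [set p | U (pos p) /\ 0 < vec p 0 i / a].

Definition radial_coord (p : 'rV[R]_(n.+1 + n.+1)) : 'rV[R]_(n + n.+1) :=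
  row_mx ((vec p 0 i / a)^-1 *: col' i (vec p)) (pos p).

Lemma col'_insert_entry u : col' i (insert_entry u) = u.
Proof. by apply/rowP => j; rewrite !mxE liftK. Qed.

Lemma insert_entryE u : insert_entry u 0 i = a.
Proof. by rewrite mxE unlift_none. Qed.

Lemma insert_entry_col' (v : 'rV[R]_n.+1) : v 0 i = a ->
  insert_entry (col' i v) = v.
Proof.
move=> vi; apply/rowP => j; rewrite mxE.
by case: unliftP => [k|] -> /=; rewrite ?mxE.
Qed.

Lemma radial_paramK w : radial_dom w -> radial_coord (radial_param w) = w.
Proof.
move=> [_ q0]; rewrite /radial_coord /radial_param row_mxKl row_mxKr mxE.
rewrite insert_entryE mulfK // invrK linearZ /= col'_insert_entry scalerA.
by rewrite mulfV ?scale1r ?hsubmxK // gt_eqF ?sqrtr_gt0.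
Qed.

Lemma radial_param_in w : radial_dom w -> (S `&` radial_codom) (radial_param w).
Proof.
move=> [Uw q0]; have s0 : 0 < Num.sqrt (radial_form w) by rewrite sqrtr_gt0.
split; split; rewrite /= ?row_mxKl ?row_mxKr //.
  rewrite -scalemxAl innerZl innerZr mulrA -invfM -expr2 sqr_sqrtr ?ltW //.
  by rewrite mulVf // gt_eqF.
by rewrite mxE insert_entryE mulfK // invr_gt0.
Qed.

Lemma radial_coordK p : (S `&` radial_codom) p ->
  radial_dom (radial_coord p) /\ radial_param (radial_coord p) = p.
Proof.
move=> [[Up level] [_ l0]]; set l := vec p 0 i / a in l0.
have wE : insert_entry (lsubmx (radial_coord p)) = l^-1 *: vec p.
  rewrite /radial_coord row_mxKl -/l -linearZ /=; apply: insert_entry_col'.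
  by rewrite mxE /l invf_div divfK //; apply: contraTneq l0;
    rewrite /l => ->; rewrite mul0r ltxx.
have qE : radial_form (radial_coord p) = l^-1 ^+ 2.
  rewrite /radial_form wE {1 2}/radial_coord row_mxKr.
  by rewrite -scalemxAl innerZl innerZr level mulr1 expr2.
split.
  by split; [rewrite /radial_coord row_mxKr|rewrite qE exprn_gt0 ?invr_gt0].
rewrite /radial_param qE wE sqrtr_sqr ger0_norm ?invr_ge0 ?ltW // invrK.
by rewrite scalerA mulfV ?gt_eqF // scale1r /radial_coord row_mxKr hsubmxK.
Qed.

Lemma diffn_insert_entry (E : normedModType R) k (W : set E)
    (u : E -> 'rV[R]_n) :
  open W -> diffn k W u -> diffn k W (fun z => insert_entry (u z)).
Proof.
move=> oW du; apply/(diffn_mxP _ _ oW) => l j; under eq_fun do rewrite mxE.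
case: (unlift i j) => [j'|] /=; last exact: diffn_cst.
by have /(diffn_mxP _ _ oW) := du; exact.
Qed.

Let oUr : open [set w : 'rV[R]_(n + n.+1) | U (rsubmx w)].
Proof.
have := @open_preimage _ _ _ setT U (rsubmx : 'rV[R]_(n + n.+1) -> _) openT oU.
by rewrite setTI; apply => z _; exact: continuous_rsubmx.
Qed.

Lemma diffn_radial_form d : diffn d [set w | U (rsubmx w)] radial_form.
Proof.
have dr := diffn_rsubmx oUr (diffn_id d oUr).
have dl := diffn_insert_entry oUr (diffn_lsubmx oUr (diffn_id d oUr)).
have comp (f : 'rV[R]_n.+1 -> 'M[R]_n.+1) : (forall d, diffn d U f) ->
    diffn d [set w : 'rV[R]_(n + n.+1) | U (rsubmx w)] (fun w => f (rsubmx w)).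
  by move=> df; apply: (diffn_comp_mx oU oUr _ (df d) dr).
apply: diffn_inner => //; first exact: comp.
by apply: diffn_mulmx => //; exact: comp.
Qed.

Lemma open_radial_dom : open radial_dom.
Proof. exact: open_positive oUr (diffn_radial_form 0). Qed.

Lemma diffn_radial_param d : diffn d radial_dom radial_param.
Proof.
have oW := open_radial_dom.
have dr := diffn_rsubmx oW (diffn_id d oW).
have dl := diffn_insert_entry oW (diffn_lsubmx oW (diffn_id d oW)).
apply: diffn_row_mx => //; apply: diffn_scalemx => //; apply: diffn_rsqrt => //.
  by move=> w [].
by apply: diffnW (diffn_radial_form d) => w [].
Qed.

Let oUl : open [set p : 'rV[R]_(n.+1 + n.+1) | U (pos p)].
Proof.
have := @open_preimage _ _ _ setT U (lsubmx : 'rV[R]_(n.+1 + n.+1) -> _)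
  openT oU.
by rewrite setTI; apply => z _; exact: continuous_lsubmx.
Qed.

Let diffn_ratio d (V : set 'rV[R]_(n.+1 + n.+1)) : open V ->
  diffn d V (fun p => vec p 0 i / a).
Proof.
move=> oV; apply: diffnM => //; last exact: diffn_cst.
by have /(diffn_mxP _ _ oV) := diffn_rsubmx oV (diffn_id d oV); exact.
Qed.

Lemma open_radial_codom : open radial_codom.
Proof. exact: open_positive oUl (diffn_ratio 0 oUl). Qed.

Lemma diffn_radial_coord d : diffn d radial_codom radial_coord.
Proof.
have oV := open_radial_codom.
apply: diffn_row_mx => //; last exact: diffn_lsubmx oV (diffn_id d oV).
apply: diffn_scalemx => //.
  by apply: diffnV => //; [move=> p [_ /lt0r_neq0]|exact: diffn_ratio].
apply/(diffn_mxP _ _ oV) => l j; under eq_fun do rewrite mxE.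
by have /(diffn_mxP _ _ oV) := diffn_rsubmx oV (diffn_id d oV); exact.
Qed.

(** The left inverse [radial_coord] is smooth on an open set of the ambient space. The chain rule
    then gives the immersion property, and the image of O is cut out by the preimage of O under
    it. *)
Lemma local_param_radial : local_param S radial_dom radial_param.
Proof.
have inj w w' : radial_dom w -> radial_dom w' ->
    radial_param w = radial_param w' -> w = w'.
  by move=> Ww Ww' e; rewrite -(radial_paramK Ww) e radial_paramK.
split=> //.
- exact: open_radial_dom.
- apply: diffn_smooth_on; exact: diffn_radial_param.
- move=> w Ww; apply: inj_row_free => v vJ.
  have dpw := diffn_differentiable (diffn_radial_param 0) Ww.
  have Vp := (radial_param_in Ww).2.
  have dcp := diffn_differentiable (diffn_radial_coord 0) Vp.
  have e1 := has_deriv_comp dcp (has_derivP v dpw).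
  have Dv : 'D_v radial_param w = 0 by rewrite deriveEjacobian.
  have := has_deriv_unique open_radial_dom Ww radial_paramK e1
    (has_deriv_id w v).
  by rewrite Dv derive0.
move=> O oO OW; exists (radial_codom `&` radial_coord @^-1` O).
  apply: open_preimage => //; first exact: open_radial_codom.
  move=> z Vz; apply: differentiable_continuous.
  exact: diffn_differentiable (diffn_radial_coord 0) Vz.
rewrite eqEsubset; split=> [_ [w Ow <-]|p [Sp [Vp Op]]].
  have [Sp Vp] := radial_param_in (OW _ Ow); split=> //; split=> //.
  by rewrite /= radial_paramK //; exact: OW.
by exists (radial_coord p) => //; have [] := radial_coordK (conj Sp Vp).
Qed.

End radial_parametrization.

(** * Planar curves *)

Section curves_in_unit_bundle.
Context {R : realType} {n : nat} (U : set 'rV[R]_n).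
Variables (g phi : 'rV[R]_n -> 'M[R]_n).
Variable C : 'rV[R]_n -> 'I_n -> 'I_n -> 'rV[R]_n.
Hypothesis pk : pkn_chart U g phi C.
Variables (x v : R -> 'rV[R]_n) (J : set R) (t : R).
Hypotheses (oJ : open J) (Jt : J t).
Hypotheses (sx : smooth_curve J x) (sv : smooth_curve J v).

Local Notation G := (sasaki C g phi).
Local Notation S := (unit_bundle g phi U).

Let Gam s := row_mx (x s) (v s).
Let dv := cov_along C x v.
Hypothesis Sgam : forall s, J s -> S (Gam s).

Lemma has_deriv_row_curve s : J s ->
  has_deriv Gam s 1 (row_mx (derive1 x s) (derive1 v s)).
Proof.
move=> Js; apply: has_deriv_row_mx.
  exact: smooth_curve_has_deriv sx Js.
exact: smooth_curve_has_deriv sv Js.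
Qed.

Lemma smooth_row_curve : smooth_curve J Gam.
Proof.
apply: diffn_smooth_curve => d; apply: (diffn_row_mx oJ).
  exact: smooth_curve_diffn.
exact: smooth_curve_diffn.
Qed.

Lemma derive1_row_curve s : J s ->
  derive1 Gam s = row_mx (derive1 x s) (derive1 v s).
Proof.
by move=> Js; have [_ <-] := has_deriv_row_curve Js; rewrite derive1E.
Qed.

Lemma hpart_derive1 : hpart (derive1 Gam t) = derive1 x t.
Proof. by rewrite derive1_row_curve // /hpart row_mxKl. Qed.

Lemma vpart_derive1 : vpart C (Gam t) (derive1 Gam t) = dv t.
Proof. by rewrite derive1_row_curve // /vpart !row_mxKl !row_mxKr. Qed.

(** Passage from coordinate second derivatives to the covariant ones: the vertical part of the
    velocity is xi', so its derivative yields xi''. *)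
Lemma unit_acceleration_curve :
  unit_acceleration g phi C (Gam t) (row_mx (derive1 x t) (derive1 v t))
    (row_mx (derive1 (derive1 x) t) (derive1 (derive1 v) t)) =
  hlift C (Gam t) (acceleration C x t -
    curvature C (x t) (dv t) (v t *m phi (x t)) (derive1 x t)) +
  vlift (cov_along C x dv t +
    inner (g (x t)) (dv t) (dv t *m phi (x t)) *: v t).
Proof.
have Ut : U (lsubmx (Gam t)) by have [] := Sgam Jt.
have dvE : vpart C (Gam t) (row_mx (derive1 x t) (derive1 v t)) = dv t.
  by rewrite /vpart !row_mxKl !row_mxKr.
have wt : has_deriv (fun s => row_mx (derive1 x s) (derive1 v s)) t 1
    (row_mx (derive1 (derive1 x) t) (derive1 (derive1 v) t)).
  apply: has_deriv_row_mx.
    exact: smooth_curve_has_deriv (smooth_curve_derive1 sx) Jt.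
  exact: smooth_curve_has_deriv (smooth_curve_derive1 sv) Jt.
have e := has_deriv_vpart pk Ut (has_deriv_row_curve Jt) wt.
have ddv : derive1 dv t = vcov C (Gam t) (row_mx (derive1 x t) (derive1 v t))
    (row_mx (derive1 x t) (derive1 v t))
    (row_mx (derive1 (derive1 x) t) (derive1 (derive1 v) t)) -
    dv t *m conn C (x t) (derive1 x t).
  rewrite derive1E; have [_] := e; rewrite dvE !row_mxKl => <-.
  apply: derive_on oJ Jt _ => s Js.
  by rewrite /vpart !row_mxKl !row_mxKr.
have hE : hcov C (Gam t) (row_mx (derive1 x t) (derive1 v t))
    (row_mx (derive1 x t) (derive1 v t))
    (row_mx (derive1 (derive1 x) t) (derive1 (derive1 v) t)) =
    acceleration C x t.
  by rewrite /hcov !row_mxKl /acceleration /cov_along christE.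
have vE : cov_along C x dv t =
    vcov C (Gam t) (row_mx (derive1 x t) (derive1 v t))
    (row_mx (derive1 x t) (derive1 v t))
    (row_mx (derive1 (derive1 x) t) (derive1 (derive1 v) t)).
  by rewrite /cov_along ddv christE subrK.
by rewrite /unit_acceleration dvE hE vE !row_mxKl row_mxKr.
Qed.

(** None of the existential witnesses behind A influences it: the right-hand side involves only the
    derivatives of x and v. *)
Lemma induced_acceleration_unique A :
  induced_acceleration (n + n).-1 S G Gam t A ->
  A = unit_acceleration g phi C (Gam t) (row_mx (derive1 x t) (derive1 v t))
    (row_mx (derive1 (derive1 x) t) (derive1 (derive1 v) t)).
Proof.
case=> W [psi [C' [J' [c [lp lc' [oJ' J't sc] hc ->]]]]].
pose K := J' `&` J.
have oK : open K by exact: openI.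
have Kt : K t by [].
have scK : smooth_curve K c by move=> k s [J's _]; exact: sc.
have Wc s : K s -> W (c s) by move=> [/hc[]].
rewrite (induced_acceleration_eq pk lp lc' oK Kt scK Wc).
have pG s : K s -> psi (c s) = Gam s by move=> [/hc[]].
have d1 s : K s ->
    derive1 c s *m 'J psi (c s) = row_mx (derive1 x s) (derive1 v s).
  move=> Ks; apply: (has_deriv_unique oK Ks pG (has_deriv_lift lp scK Wc Ks)).
  exact: has_deriv_row_curve Ks.2.
rewrite (d1 t Kt) (pG t Kt); congr unit_acceleration.
apply: (has_deriv_unique oK Kt d1 (has_deriv_lift2 lp Kt scK Wc)).
apply: has_deriv_row_mx.
  exact: smooth_curve_has_deriv (smooth_curve_derive1 sx) Jt.
exact: smooth_curve_has_deriv (smooth_curve_derive1 sv) Jt.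
Qed.

End curves_in_unit_bundle.

Lemma exists_induced_acceleration (R : realType) (n : nat) (U : set 'rV[R]_n)
    (g phi : 'rV[R]_n -> 'M[R]_n) (C : 'rV[R]_n -> 'I_n -> 'I_n -> 'rV[R]_n)
    (Gam : R -> 'rV[R]_(n + n)) (J : set R) (t : R) :
  pkn_chart U g phi C -> open J -> J t -> smooth_curve J Gam ->
  (forall s, J s -> unit_bundle g phi U (Gam s)) ->
  exists A, induced_acceleration (n + n).-1 (unit_bundle g phi U)
    (sasaki C g phi) Gam t A.
Proof.
move=> pk oJ Jt sG SG; have [_ level] := SG _ Jt.
(* The level equation excludes xi = 0; a nonzero entry at time t is the one held fixed by the
   parametrization. *)
have [i vi] : exists i, rsubmx (Gam t) 0 i != 0.
  apply/rV0Pn; apply: contra_eq_neq level => ->.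
  by rewrite inner0l eq_sym oner_neq0.
move: U g phi C Gam pk i SG sG level vi.
(* In successor form, (n.+1 + n.+1).-1 computes to n + n.+1, the dimension of the radial
   parameters. *)
case: n => [|n] U g phi C Gam pk i SG sG _ vi; first by case: i vi.
have lp := local_param_radial (pc_open pk) (pc_gram_smooth pk)
  (pc_phi_smooth pk) i vi.
have [C' lc'] := exists_induced_connection pk lp.
set a := rsubmx (Gam t) 0 i in vi lp C' lc'.
set W := radial_dom U g phi i a in lp C' lc'.
set psi := radial_param g phi i a in lp C' lc'.
pose V := radial_codom U i a.
have oV : open V by exact: (@open_radial_codom _ _ _ (pc_open pk) i a).
(* Time is restricted to where the chosen entry keeps its sign, so that the curve stays in the
   parametrized piece. *)
pose K := J `&` Gam @^-1` V.
have cG s : J s -> {for s, continuous Gam}.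
  move=> Js.
  by have [/differentiable_continuous] := smooth_curve_has_deriv sG Js.
have oK : open K := open_preimage oJ oV cG.
have Kt : K t.
  split=> //; split; first by have [] := SG _ Jt.
  by rewrite divff // ltr01.
have KW s : K s -> W (radial_coord i a (Gam s)) /\
    psi (radial_coord i a (Gam s)) = Gam s.
  by move=> [Js Vs]; apply: radial_coordK; split=> //; exact: SG.
eexists; exists W, psi, C', K, (radial_coord i a \o Gam); split=> //.
split=> //; apply: diffn_smooth_curve => d.
apply: (@diffn_comp_mx _ _ _ _ _ _ V K (radial_coord i a) Gam) => // [s []//||].
  exact: (@diffn_radial_coord _ _ U (pc_open pk) i a d).
by apply: diffnW (smooth_curve_diffn d oJ sG) => s [].
Qed.

Section lift_components.
Context {R : realType} {n : nat}.
Variable C : 'rV[R]_n -> 'I_n -> 'I_n -> 'rV[R]_n.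

Lemma hv_eq p w w' : hpart w = hpart w' -> vpart C p w = vpart C p w' -> w = w'.
Proof.
by move=> hw vw; rewrite (hv_decomposition C p w) hw vw -hv_decomposition.
Qed.

Lemma planar_components (F : 'rV[R]_n -> 'M[R]_n) p w X Y (r1 r2 : R) :
  hlift C p X + vlift Y = r1 *: w + r2 *: hlift_endo C F p w <->
  X = r1 *: hpart w + r2 *: (hpart w *m F (lsubmx p)) /\
  Y = r1 *: vpart C p w + r2 *: (vpart C p w *m F (lsubmx p)).
Proof.
have hE : hpart (r1 *: w + r2 *: hlift_endo C F p w) =
    r1 *: hpart w + r2 *: (hpart w *m F (lsubmx p)).
  rewrite -[LHS]/(lsubmx _) linearD !linearZ /=; congr (_ + _ *: _).
  exact: hpart_lift.
have vE : vpart C p (r1 *: w + r2 *: hlift_endo C F p w) =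
    r1 *: vpart C p w + r2 *: (vpart C p w *m F (lsubmx p)).
  have v0 : vpart C p 0 = 0.
    by have := vpartP C p (-1) 0 0; rewrite scaler0 addr0 scaleN1r addNr.
  rewrite vpartP -[r2 *: hlift_endo _ _ _ _]addr0 vpartP v0 addr0.
  by congr (_ + _ *: _); exact: vpart_lift.
split=> [e|[-> ->]].
  by rewrite -hE -vE -e hpart_lift vpart_lift.
by apply: (@hv_eq p); rewrite ?hpart_lift ?vpart_lift ?hE ?vE.
Qed.

End lift_components.

Lemma pkn_chart_img (R : realType) (m : nat) (M : manifold R (2 * m))
    (phi : endo_field M) (g : riemannian_metric M)
    (C : chart M -> 'rV[R]_(2 * m) -> 'I_(2 * m) -> 'I_(2 * m) ->
         'rV[R]_(2 * m)) (a : chart M) :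
  para_kahler_norden phi g C -> pkn_chart (img a) (g a) (phi a) (C a).
Proof.
move=> pkn; have oU : open (img a) by exact: open_img.
split=> //.
- by move=> d; apply: smooth_on_diffn => //; exact: smooth_gram.
- by move=> d; apply: smooth_on_diffn => //; exact: smooth_endo.
- by move=> y; exact: gram_sym.
- by move=> y v; exact: gram_pos.
- exact: (pkn_levi_civita pkn a).
- by move=> y; exact: (pkn_invol pkn).
- by move=> y u v; exact: (pkn_pure pkn).
- exact: (pkn_parallel pkn).
Qed.

Theorem theorem5p9 (R : realType) (m : nat) (M : manifold R (2 * m))
  (phi : endo_field M) (g : riemannian_metric M)
  (C : chart M -> 'rV[R]_(2 * m) -> 'I_(2 * m) -> 'I_(2 * m) -> 'rV[R]_(2 * m))
  (pknM : para_kahler_norden phi g C)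
  (F : endo_field M)
  (I : interval R) (openI : open [set` I])
  (gam : R -> M) (xi : R -> chart M -> 'rV[R]_(2 * m))
  (curveGam : bundle_curve [set` I] gam xi)
  (unitGam : forall t a, t \in I -> dom a (gam t) ->
    unit_bundle (g a) (phi a) (img a) (crd_bundle_curve gam xi a t))
  (rho : R) (rho_ge0 : 0 <= rho) (rho_le1 : rho <= 1)
  (rhoE : forall t a, t \in I -> dom a (gam t) ->
    let x := crd_curve gam a in
    let dv := cov_along (C a) x (crd_field xi a) in
    rho ^+ 2 = inner (g a (x t)) (dv t) (dv t *m phi a (x t))) :
  HF_planar phi g C F [set` I] gam xi <->
  exists rho1 rho2 : R -> R, forall t a, t \in I -> dom a (gam t) ->
    let x := crd_curve gam a in
    let v := crd_field xi a in
    let dx := derive1 x in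
    let ddx := acceleration (C a) x in
    let dv := cov_along (C a) x v in
    let ddv := cov_along (C a) x dv in
    ddx t = curvature (C a) (x t) (dv t) (v t *m phi a (x t)) (dx t)
            + rho1 t *: dx t + rho2 t *: (dx t *m F a (x t))
    /\ ddv t = rho1 t *: dv t + rho2 t *: (dv t *m F a (x t)) - rho ^+ 2 *: v t.
Proof.
(* The equivalence holds pointwise in t and in each chart, with the same two coefficients on both
   sides. *)
suff main r1 r2 t a : t \in I -> dom a (gam t) ->
    let Gam := crd_bundle_curve gam xi a in
    let x := crd_curve gam a in
    let v := crd_field xi a in
    let dv := cov_along (C a) x v in
    induced_acceleration (2 * m + 2 * m).-1
      (unit_bundle (g a) (phi a) (img a)) (sasaki (C a) (g a) (phi a)) Gam t
      (r1 *: derive1 Gam t +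
       r2 *: hlift_endo (C a) (F a) (Gam t) (derive1 Gam t)) <->
    acceleration (C a) x t =
      curvature (C a) (x t) (dv t) (v t *m phi a (x t)) (derive1 x t)
      + r1 *: derive1 x t + r2 *: (derive1 x t *m F a (x t))
    /\ cov_along (C a) x dv t =
      r1 *: dv t + r2 *: (dv t *m F a (x t)) - rho ^+ 2 *: v t.
  split=> -[r1 [r2 planar]]; exists r1, r2 => t a It at_;
    by have [? ?] := main (r1 t) (r2 t) t a It at_; auto.
move=> It at_ Gam x v dv.
have pk := pkn_chart_img a pknM.
pose J := [set` I] `&` gam @^-1` dom a.
have oJ : open J.
  apply: open_preimage => //; first exact: open_dom.
  exact: (bc_continuous curveGam).
have Jt : J t by [].
have sx : smooth_curve J x by exact: (bc_smooth curveGam).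
have sv : smooth_curve J v by exact: (bc_field_smooth curveGam).
have SG s : J s -> unit_bundle (g a) (phi a) (img a) (Gam s).
  by move=> [Is as_]; exact: unitGam.
have sG : smooth_curve J Gam := smooth_row_curve oJ sx sv.
have uniq A : induced_acceleration (2 * m + 2 * m).-1
    (unit_bundle (g a) (phi a) (img a)) (sasaki (C a) (g a) (phi a)) Gam t A ->
    A = hlift (C a) (Gam t) (acceleration (C a) x t -
      curvature (C a) (x t) (dv t) (v t *m phi a (x t)) (derive1 x t))
      + vlift (cov_along (C a) x dv t + rho ^+ 2 *: v t).
  move=> /(induced_acceleration_unique pk oJ Jt sx sv) ->.
  by rewrite (unit_acceleration_curve pk oJ Jt sx sv SG) (rhoE t a It at_).
have [A accA] := exists_induced_acceleration pk oJ Jt sG SG.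
have hE := hpart_derive1 Jt sx sv.
have vE := vpart_derive1 (C a) Jt sx sv.
have posE : lsubmx (Gam t) = x t by rewrite row_mxKl.
have := planar_components (C a) (F a) (Gam t) (derive1 Gam t)
  (acceleration (C a) x t -
    curvature (C a) (x t) (dv t) (v t *m phi a (x t)) (derive1 x t))
  (cov_along (C a) x dv t + rho ^+ 2 *: v t) r1 r2.
rewrite hE vE posE => comps.
split=> [/uniq/esym/comps[eh ev]|[eh ev]].
  split; last by rewrite -ev addrK.
  by rewrite -addrA -eh addrC subrK.
(* For the converse, some acceleration [A] exists; uniqueness computes it, and the two equations
   identify the result with the planar combination. *)
have /comps <- : acceleration (C a) x t -
    curvature (C a) (x t) (dv t) (v t *m phi a (x t)) (derive1 x t) =
    r1 *: derive1 x t + r2 *: (derive1 x t *m F a (x t)) /\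
    cov_along (C a) x dv t + rho ^+ 2 *: v t =
    r1 *: dv t + r2 *: (dv t *m F a (x t)).
  split; last by rewrite ev subrK.
  by apply/eqP; rewrite subr_eq eh -addrA addrC.
by rewrite -(uniq A accA).
Qed.
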